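(* Let $\alpha\in F\setminus\{0\}$ and $k\ge2$. Then $\mathrm{Id}^{tr}\big(C_k^{t_{\alpha,0}}\big)$ is generated, as a $T^{tr}$-ideal, by the polynomials \begin{align*} f_1&=[x_1,x_2],\\ g_6&=\mathrm{Tr}(x_1)\mathrm{Tr}(x_2)-\alpha\mathrm{Tr}(x_1x_2),\\ g_7&=(\mathrm{Tr}(x_1)-\alpha x_1)\cdots(\mathrm{Tr}(x_k)-\alpha x_k). \end{align*} Moreover, $c_n^{tr}\big(C_k^{t_{\alpha,0}}\big)=\sum_{i=0}^{k-1}\binom ni\approx\frac{n^{k-1}}{(k-1)!}$.
   Context: $F$ is a field of characteristic zero; all algebras are associative, unitary, over $F$. An algebra with trace is an algebra $A$ with a linear map $\mathrm{tr}\colon A\to F$ such that $\mathrm{tr}(ab)=\mathrm{tr}(ba)$ for all $a,b\in A$; $F$ is identified with $F\cdot 1_A\subseteq A$. Let $X=\{x_1,x_2,\dots\}$ and let $\mathcal M$ be the set of (nonempty) monomials in the noncommuting variables of $X$. The free algebra with trace is $F\langle X,\mathrm{Tr}\rangle\cong F\langle X\rangle\otimes F[\mathrm{Tr}(M)\mid M\in\mathcal M]$, where the $\mathrm{Tr}(M)$ are central commuting variables subject to $\mathrm{Tr}(MN)=\mathrm{Tr}(NM)$ and $\mathrm{Tr}(\mathrm{Tr}(M)N)=\mathrm{Tr}(M)\mathrm{Tr}(N)$. Its elements are called trace polynomials; the symbol $\mathrm{Tr}(1)$ does not occur. A trace polynomial is pure if all its variables appear inside traces. A trace polynomial $f(x_1,\dots,x_n,\mathrm{Tr})$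 is a trace identity of $A$ if it vanishes whenever the $x_i$ are replaced by arbitrary elements of $A$ and $\mathrm{Tr}$ by $\mathrm{tr}$. $\mathrm{Id}^{tr}(A)$ is the set of all trace identities of $A$. A $T^{tr}$-ideal (trace $T$-ideal) is an ideal of $F\langle X,\mathrm{Tr}\rangle$ invariant under all endomorphisms (substitutions of the variables by linear combinations, with coefficients in $F[\mathrm{Tr}(M)\mid M\in\mathcal M]$, of nonempty monomials, compatibly with $\mathrm{Tr}$) and closed under taking traces ($f\mapsto \mathrm{Tr}(fM)$ for $M\in\mathcal M$, and $f\mapsto\mathrm{Tr}(f)$ when $f$ has no pure trace term). The $T^{tr}$-ideal generated by a set is the smallest one containing it. $[x_1,x_2]=x_1x_2-x_2x_1$. $MT_n$ is the space of multilinear trace polynomials in $x_1,\dots,x_n$, spanned by the elements $\mathrm{Tr}(x_{i_1}\cdots x_{i_a})\cdots\mathrm{Tr}(x_{j_1}\cdots x_{j_b})x_{l_1}\cdots x_{l_c}$ in which each of $x_1,\dots,x_n$ occurs exactly once. The $n$-th trace codimension ($n\ge1$) is $c_n^{tr}(A)=\dim_F MT_n/(MT_n\cap\mathrm{Id}^{tr}(A))$. The symbol $\approx$ denotes asymptotic equality as $n\to\infty$ (ratio tends to $1$). For $k\ge1$, $C_k$ is the algebra of $k\times k$ upper triangular Toeplitz matrices over $F$, i.e. matrices whose $(i,j)$ entry is $a_{j-i+1}$ for $j\ge i$ and $0$ for $j<i$, with $a_1,\dots,a_k\in F$ (so $C_k\cong F[x]/(x^k)$). $C_k^{t_{\alpha,0}}$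 is $C_k$ with the trace sending such a matrix to $\alpha a_1$. *)

(* Defs.v *)
(* [normedtype] is deliberately not imported: its notations clash with those
   of [monalg]. *)
From HB Require Import structures.
From mathcomp Require Import all_boot all_order all_algebra.
From mathcomp Require Import finmap.
From mathcomp.multinomials Require Import monalg.
From mathcomp Require Import boolp classical_sets reals topology.

Set Implicit Arguments.
Unset Strict Implicit.
Unset Printing Implicit Defensive.

Import Order.TTheory GRing.Theory Num.Theory.
Import numFieldTopology.Exports.

Local Open Scope ring_scope.
Local Open Scope quotient_scope.

(* Letters are natural numbers: the letter i stands for the variable x_(i+1). *)
Definition nword := {w : seq nat | w != [::]}.

Definition rot_equiv (u v : nword) : bool :=
  has (fun i => sval v == rot i (sval u)) (iota 0 (size (sval u)).+1).

Lemma rot_equivP (u v : nword) :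
  reflect (exists i, sval v = rot i (sval u)) (rot_equiv u v).
Proof.
apply: (iffP hasP) => [[i _ /eqP]|[i e]]; first by exists i.
case: (leqP i (size (sval u))) => [le_i|lt_i].
  by exists i; [rewrite mem_iota add0n ltnS | apply/eqP].
by exists 0%N; rewrite ?mem_iota // rot0 e rot_oversize // ltnW.
Qed.

Lemma rot_equiv_refl : reflexive rot_equiv.
Proof. by move=> u; apply/rot_equivP; exists 0%N; rewrite rot0. Qed.

Lemma rot_equiv_sym : symmetric rot_equiv.
Proof.
suff sub u v : rot_equiv u v -> rot_equiv v u.
  by move=> u v; apply/idP/idP; exact: sub.
case/rot_equivP=> i e; apply/rot_equivP; exists (size (sval v) - i)%N.
by rewrite e -/(rotr i _) rotK.
Qed.

Lemma rot_equiv_trans : transitive rot_equiv.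
Proof.
move=> v u w /rot_equivP[i e] /rot_equivP[j e']; apply/rot_equivP.
have [le_i|/ltnW le_i] := leqP i (size (sval u)); last first.
  by exists j; rewrite e' e (rot_oversize le_i).
have [le_j|/ltnW le_j] := leqP j (size (sval u)); last first.
  by exists i; rewrite e' e rot_oversize ?size_rot.
by rewrite e' e rot_add_mod //; eexists.
Qed.

Canonical rot_equiv_rel :=
  EquivRel rot_equiv rot_equiv_refl rot_equiv_sym rot_equiv_trans.

(* Nonempty words modulo MN ~ NM: the symbols Tr(M). *)
Definition cycword := {eq_quot rot_equiv}.
HB.instance Definition _ := Choice.on cycword.

(* F[Tr(M) | M], then F<X,Tr>, seen as the algebra of noncommutative
   polynomials in X with coefficients in F[Tr(M) | M]. *)
Notation puretr F := {malg F[{cmonom cycword}]}.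
Notation trpoly F := {malg (puretr F)[{fmonom nat}]}.

Section FreeTraceAlgebra.
Variable F : fieldType.

Definition word (w : seq nat) : trpoly F := << FMonom w >>.
Definition var (i : nat) : trpoly F := word [:: i].

(* Tr(1) does not exist; [Trw [::]] has the dummy value 0, and [Tr] is only
   applied below to trace polynomials without pure trace term. *)
Definition Trw (w : seq nat) : puretr F :=
  if insub w is Some u then << ucm (\pi_cycword (u : nword)) >> else 0.

Definition Trc (f : trpoly F) : puretr F :=
  \sum_(w <- msupp f) f@_w * Trw w.

Definition Tr (f : trpoly F) : trpoly F := (Trc f)%:MP.

(* A trace polynomial has no pure trace term when its coefficient (in
   F[Tr(M) | M]) at the empty word vanishes. *)
Definition no_pure_term (f : trpoly F) : Prop := f@_(mone : {fmonom nat}) = 0.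

End FreeTraceAlgebra.

(* Replaces each x_i by a i and Tr by tr, where the values live in an algebra A
   over a commutative F-algebra S (through h : F -> S) and tr : A -> S.  This
   covers both evaluation in an algebra with trace (S = F) and substitution in
   F<X,Tr> itself (S = F[Tr(M) | M]). *)
Section Eval.
Variables (F : fieldType) (S : comNzRingType) (A : lalgType S).
Variables (h : F -> S) (tr : A -> S) (a : nat -> A).

Definition weval (w : seq nat) : A := \prod_(i <- w) a i.

Definition ceval (m : {cmonom cycword}) : S :=
  \prod_(c <- finsupp m) tr (weval (sval (repr c))) ^+ m c.

Definition peval (p : puretr F) : S := \sum_(m <- msupp p) h p@_m * ceval m.

Definition treval (f : trpoly F) : A :=
  \sum_(w <- msupp f) peval f@_w *: weval w.

End Eval.

Definition trsubst (F : fieldType) (s : nat -> trpoly F) (f : trpoly F) :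
  trpoly F := treval (fun c : F => c%:MP) (@Trc F) s f.

Record Ttr_ideal (F : fieldType) (I : set (trpoly F)) : Prop := {
  Ttr_ideal0 : I 0;
  Ttr_idealD : forall f g : trpoly F, I f -> I g -> I (f + g);
  Ttr_idealMl : forall f g : trpoly F, I g -> I (f * g);
  Ttr_idealMr : forall f g : trpoly F, I f -> I (f * g);
  Ttr_ideal_subst : forall (s : nat -> trpoly F) (f : trpoly F),
    (forall i, no_pure_term (s i)) -> I f -> I (trsubst s f);
  Ttr_ideal_TrM : forall (f : trpoly F) (w : seq nat),
    w != [::] -> I f -> I (Tr (f * word F w));
  Ttr_ideal_Tr : forall f : trpoly F, no_pure_term f -> I f -> I (Tr f)
}.

Definition Ttr_ideal_gen (F : fieldType) (G : set (trpoly F)) :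
  set (trpoly F) := smallest (@Ttr_ideal F) G.

Record traceAlgType (F : fieldType) := TraceAlg {
  tralg_sort :> algType F;
  tralg_tr : {scalar tralg_sort};
  tralg_trC : forall a b : tralg_sort, tralg_tr (a * b) = tralg_tr (b * a)
}.

Definition Idtr (F : fieldType) (A : traceAlgType F) : set (trpoly F) :=
  [set f | forall a : nat -> A, treval id (@tralg_tr F A) a f = 0]%classic.

Section Codimension.
Variable F : fieldType.

Definition multilin_monomial (n : nat) (f : trpoly F) : Prop :=
  exists (us : seq (seq nat)) (w : seq nat),
    [/\ all (fun u => u != [::]) us,
        perm_eq (flatten us ++ w) (iota 0 n)
      & f = (\prod_(u <- us) Tr (word F u)) * word F w].

(* c%:MP *: f is the F-scaling of f by c. *)
Definition MT (n : nat) : set (trpoly F) :=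
  [set f | exists (m : nat) (c : 'I_m -> F) (e : 'I_m -> trpoly F),
    (forall i, multilin_monomial n (e i)) /\
    f = \sum_(i < m) (c i)%:MP *: e i]%classic.

(* The quotient V/W has a basis of d elements, given by the classes of the
   e i. *)
Definition has_quotient_dim (V W : set (trpoly F)) (d : nat) : Prop :=
  exists e : 'I_d -> trpoly F,
    [/\ forall i, V (e i),
        forall c : 'I_d -> F,
          W (\sum_(i < d) (c i)%:MP *: e i) -> forall i, c i = 0
      & forall v, V v -> exists c : 'I_d -> F,
          W (v - \sum_(i < d) (c i)%:MP *: e i)].

(* MT n is finite dimensional, so that the default value 0 of [xget] is not
   used. *)
Definition trcodim (A : traceAlgType F) (n : nat) : nat :=
  xget 0%N [set d | has_quotient_dim (MT n) (MT n `&` Idtr A) d]%classic.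

End Codimension.

Definition asymp_eq (R : realType) (u v : nat -> R) : Prop :=
  ((u n / v n) @[n --> \oo] --> (1 : R))%classic.

Section Toeplitz.
Variables (F : fieldType) (k : nat).

(* The size is k, for k >= 1; it is written k.-1.+1 because only matrices of
   manifestly positive size form an [algType]. *)
Definition toeplitz_mx (a : 'rV[F]_k.-1.+1) : 'M[F]_k.-1.+1 :=
  \matrix_(i, j) (if (i <= j)%N then a ord0 (inord (j - i)) else 0).

Definition toeplitz_pred : pred 'M[F]_k.-1.+1 :=
  fun M => M == toeplitz_mx (row ord0 M).
Definition toeplitz := [qualify a M | toeplitz_pred M].

Lemma toeplitzP (M : 'M[F]_k.-1.+1) :
  reflect (exists a, M = toeplitz_mx a) (M \is a toeplitz).
Proof.
apply: (iffP eqP) => [->|[a ->]]; first by eexists.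
by apply/matrixP => i j; rewrite !mxE subn0 inordK // (leq_ltn_trans (leq_subr i j)).
Qed.

Lemma toeplitz_entriesP (M : 'M[F]_k.-1.+1) :
  reflect (exists a : nat -> F,
             forall i j, M i j = if (i <= j)%N then a (j - i)%N else 0)
          (M \is a toeplitz).
Proof.
apply: (iffP eqP) => [-> | [a Ma]].
  by exists (fun d => row ord0 M ord0 (inord d)) => i j; rewrite mxE.
apply/matrixP => i j; rewrite !mxE !Ma subn0 inordK //.
exact: leq_ltn_trans (leq_subr i j) (ltn_ord j).
Qed.

Lemma toeplitz_subalg : GRing.subsemialg_closed toeplitz.
Proof.
split.
- apply/toeplitz_entriesP; exists (fun d => (d == 0)%:R) => i j.
  rewrite !mxE subn_eq0 -val_eqE /= eqn_leq.
  by case: (i <= j)%N.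
- split=> [|A B /toeplitz_entriesP[a Aa] /toeplitz_entriesP[b Bb]].
    by apply/toeplitz_entriesP; exists (fun=> 0) => i j; rewrite mxE if_same.
  apply/toeplitz_entriesP; exists (fun d => a d + b d) => i j.
  by rewrite mxE Aa Bb; case: ifP => // _; rewrite addr0.
- move=> c A /toeplitz_entriesP[a Aa].
  apply/toeplitz_entriesP; exists (fun d => c * a d) => i j.
  by rewrite mxE Aa; case: ifP => // _; rewrite mulr0.
move=> A B /toeplitz_entriesP[a Aa] /toeplitz_entriesP[b Bb].
apply/toeplitz_entriesP.
exists (fun d => \sum_(0 <= l < d.+1) a l * b (d - l)%N) => i j.
rewrite mxE; under eq_bigr => l _ do rewrite Aa Bb.
pose G l := (if (i <= l)%N then a (l - i)%N else 0) *
            (if (l <= j)%N then b (j - l)%N else 0).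
rewrite -(big_mkord xpredT G).
case: ifP => le_ij; last first.
  rewrite big1 // => l _; rewrite /G; case: ifP => il; last by rewrite mul0r.
  case: ifP => lj; last by rewrite mulr0.
  by rewrite (leq_trans il lj) in le_ij.
rewrite (@big_cat_nat _ _ _ i) //=; last exact: ltnW.
rewrite big_nat_cond big1 ?add0r => [|l]; last first.
  by rewrite andbT /= => li; rewrite /G leqNgt li mul0r.
rewrite (@big_cat_nat _ _ _ j.+1) //=; last exact: leqW.
rewrite [X in _ + X]big_nat_cond [X in _ + X]big1 ?addr0 => [|l]; last first.
  by rewrite andbT => /andP[jl _]; rewrite /G (leqNgt l j) jl mulr0.
rewrite -{1}(add0n (i : nat)) big_addn subSn //.
apply: eq_big_nat => l /andP[_]; rewrite ltnS => lji.
have lj : (l + i <= j)%N by rewrite -(subnK le_ij) leq_add2r.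
by rewrite /G leq_addl addnK lj (addnC l) subnDA.
Qed.

HB.instance Definition _ := GRing.isSubalgClosed.Build F 'M[F]_k.-1.+1
  toeplitz_pred toeplitz_subalg.

Record toeplitz_alg :=
  ToeplitzAlg { toeplitz_val :> 'M[F]_k.-1.+1; _ : toeplitz_val \is a toeplitz }.

HB.instance Definition _ := [isSub for toeplitz_val].
HB.instance Definition _ := [Choice of toeplitz_alg by <:].
HB.instance Definition _ := [SubChoice_isSubAlgebra of toeplitz_alg by <:].

(* The entry a_1 is the top left one. *)
Definition toeplitz_tr (alpha : F) (M : toeplitz_alg) : F :=
  alpha * toeplitz_val M ord0 ord0.

Lemma toeplitz_tr_scalar (alpha : F) : scalar (toeplitz_tr alpha).
Proof. 
by move=> c A B; rewrite /toeplitz_tr !mxE mulrDr mulrCA.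
Qed.

HB.instance Definition _ (alpha : F) :=
  GRing.isLinear.Build F toeplitz_alg F *%R (toeplitz_tr alpha)
    (toeplitz_tr_scalar alpha).

Lemma toeplitz_trC (alpha : F) (A B : toeplitz_alg) :
  toeplitz_tr alpha (A * B) = toeplitz_tr alpha (B * A).
Proof.
suff mul00 (C D : toeplitz_alg) :
    toeplitz_val (C * D) ord0 ord0
      = toeplitz_val C ord0 ord0 * toeplitz_val D ord0 ord0.
  by rewrite /toeplitz_tr !mul00 [X in _ * X]mulrC.
rewrite mxE big_ord_recl big1 ?addr0 // => i _.
by have /toeplitz_entriesP[d ->] := valP D; rewrite mulr0.
Qed.

Definition toeplitz_tralg (alpha : F) : traceAlgType F :=
  TraceAlg (toeplitz_trC alpha).

End Toeplitz.

Section Generators.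
Variable F : fieldType.

Local Notation x := (var F).

Definition f1 : trpoly F := x 0 * x 1 - x 1 * x 0.

Definition g6 (alpha : F) : trpoly F :=
  Tr (x 0) * Tr (x 1) - alpha%:MP *: Tr (x 0 * x 1).

Definition g7 (alpha : F) (k : nat) : trpoly F :=
  \prod_(i < k) (Tr (x i) - alpha%:MP *: x i).

End Generators.

(* Main.v *)
Require Import Defs.
From HB Require Import structures.
From mathcomp Require Import all_boot all_order all_algebra.
From mathcomp Require Import finmap.
From mathcomp.multinomials Require Import monalg.
From mathcomp Require Import boolp classical_sets reals topology.
From mathcomp Require Import ring normedtype sequences.

Set Implicit Arguments.
Unset Strict Implicit.
Unset Printing Implicit Defensive.

Import Order.TTheory GRing.Theory Num.Theory.

Local Open Scope ring_scope.

(** Write C_k as F[t]/(t^k) with t the shift matrix. It is commutative, its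
    trace is alpha times the augmentation eps : C_k -> F, and alpha a - tr a is
    alpha times the nilpotent part of a. Since eps is multiplicative and a
    product of k nilpotent parts is divisible by t^k = 0, the polynomials f1,
    g6 and g7 are identities.

    Conversely, let I be the ideal that they generate, and put
    y_i = Tr(x_i), z_i = Tr(x_i) - alpha x_i. The substitutions of f1 make the
    free algebra commutative modulo I ([Ttr_ideal_comm]), those of g6 reduce
    Tr(x_i1 ... x_im) to a multiple of y_i1 ... y_im ([Ttr_ideal_Tr_mul]), and
    x_i is a combination of y_i and z_i. So every trace polynomial is congruent
    to a polynomial in the commuting y_i, z_i ([all_has_nf]), in which, by g7,
    the monomials of degree at least k in the z_i vanish
    ([gprod_nilgen_ideal]). If f is an identity, its normal form is one too,
    and it suffices to see that the coefficients of its monomials of z-degree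
    d < k cancel. To this end, evaluate y_i and z_i at s^(N^(2i)) and
    s^(N^(2i+1)) t with s in F. A monomial becomes s^w t^d, where
    d is its z-degree and w has the exponents of the monomial as digits in base
    N, so that distinct monomials have distinct weights for N large. The
    coefficient of t^d is a polynomial in s that vanishes on the infinite field
    F, hence it is zero, and so are the coefficients that it collects
    ([Idtr_lincomb_coef]).

    For the codimensions, a basis of the multilinear polynomials in n variables
    modulo the identities is given by the products of the z_i with i in S and
    the y_i with i not in S, for S of cardinal less than k. They span because a
    multilinear monomial evaluates to a combination of all such products, those
    with #|S| >= k being zero ([eval_monomial]). They are free because sending
    x_i to t for i in S and to 1 for i not in S kills all these products but
    the one indexed by S ([eval_nilset_indicator]). Counting the sets S gives
    the sum of the binomials 'C(n, i) for i < k, and 'C(n, i) / n^(k-1) tends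
    to 1/(k-1)! for i = k-1 and to 0 for smaller i. *)

(** * Evaluation of trace polynomials *)

(** The scalars act centrally and tr is cyclic; this covers the evaluations in
    an algebra with trace (S = F) as well as the substitutions in the free
    algebra itself (S = F[Tr(M) | M]). *)
Section TrevalTheory.
Variables (F : fieldType) (S : comNzRingType) (A : lalgType S).
Hypothesis scaleAr : forall (c : S) (u v : A), c *: (u * v) = u * (c *: v).
Variables (h : {rmorphism F -> S}) (tr : {scalar A}).
Hypothesis trC : forall u v : A, tr (u * v) = tr (v * u).
Variable a : nat -> A.

Local Notation wev := (weval a).
Local Notation cev := (ceval tr a).
Local Notation pev := (peval h tr a).
Local Notation ev := (treval h tr a).

Lemma weval_cat u v : wev (u ++ v) = wev u * wev v.
Proof. by rewrite /weval big_cat. Qed.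

Lemma tr_weval_rot (u v : nword) :
  rot_equiv u v -> tr (wev (sval v)) = tr (wev (sval u)).
Proof.
case/rot_equivP=> i ->; rewrite -[in RHS](cat_take_drop i (sval u)) /rot.
by rewrite !weval_cat trC.
Qed.

Lemma cevalEw (d : {fset cycword}) (m : {cmonom cycword}) :
  (finsupp m `<=` d)%fset ->
  cev m = \prod_(c <- d) tr (wev (sval (repr c))) ^+ m c.
Proof.
move=> le; rewrite /ceval (big_fset_incl _ le) //= => c _.
by rewrite memNfinsupp => /eqP ->; rewrite expr0.
Qed.

(** Being morphisms of monoids on both kinds of monomials is what makes the
    evaluation a morphism of rings. *)
Lemma ceval_mmorphism : mmorphism cev.
Proof.
split=> [m1 m2|]; last by rewrite /ceval mdom1 big_seq_fset0.
rewrite (cevalEw (fsubsetUl (finsupp m1) (finsupp m2))).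
rewrite (cevalEw (fsubsetUr (finsupp m1) (finsupp m2))) -big_split -mdomD /=.
by apply: eq_bigr => c _; rewrite cmM exprD.
Qed.

HB.instance Definition _ := isMultiplicative.Build _ _ _ ceval_mmorphism.

Lemma pevalE : pev = mmap h cev. Proof. by []. Qed.

Let ph : {rmorphism puretr F -> S} := mmap h cev.

Let wev' (w : {fmonom nat}) := wev w.
Lemma weval_mmorphism : mmorphism wev'.
Proof.
split=> [m1 m2|]; first by rewrite /wev' fmM weval_cat.
by rewrite /wev' fm1 /weval big_nil.
Qed.
HB.instance Definition _ := isMultiplicative.Build _ _ _ weval_mmorphism.

Lemma trevalE f : ev f = mmap (in_alg A \o ph) wev' f.
Proof. by apply: eq_bigr => w _; rewrite -mulr_algl. Qed.

Lemma treval_rmorphism : {g : {rmorphism trpoly F -> A} | g =1 ev}.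
Proof.
pose g := mmap (in_alg A \o ph) wev'.
have [|M U] := @commr_mmap_is_multiplicative _ _ _ (in_alg A \o ph) wev'.
  by move=> f m m' /=; rewrite /GRing.comm mulr_algl -scaleAr mulr1.
have g_mon : monoid_morphism g by [].
pose G := GRing.isMonoidMorphism.Build _ _ g g_mon.
pose g' : {rmorphism trpoly F -> A} := HB.pack g G.
by exists g' => f; rewrite trevalE.
Qed.

Lemma treval0 : ev 0 = 0.
Proof. by have [g gE] := treval_rmorphism; rewrite -gE rmorph0. Qed.

Lemma treval1 : ev 1 = 1.
Proof. by have [g gE] := treval_rmorphism; rewrite -gE rmorph1. Qed.

Lemma trevalD : {morph ev : f g / f + g}.
Proof. by have [g gE] := treval_rmorphism => u v; rewrite -!gE rmorphD. Qed.

Lemma trevalB : {morph ev : f g / f - g}.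
Proof. by have [g gE] := treval_rmorphism => u v; rewrite -!gE rmorphB. Qed.

Lemma trevalM : {morph ev : f g / f * g}.
Proof. by have [g gE] := treval_rmorphism => u v; rewrite -!gE rmorphM. Qed.

Lemma treval_sum I (r : seq I) P G :
  ev (\sum_(i <- r | P i) G i) = \sum_(i <- r | P i) ev (G i).
Proof.
have [g gE] := treval_rmorphism; rewrite -gE rmorph_sum.
by apply: eq_bigr => i _.
Qed.

Lemma treval_prod I (r : seq I) P G :
  ev (\prod_(i <- r | P i) G i) = \prod_(i <- r | P i) ev (G i).
Proof.
have [g gE] := treval_rmorphism; rewrite -gE rmorph_prod.
by apply: eq_bigr => i _.
Qed.

Lemma trevalC p : ev p%:MP = (pev p)%:A.
Proof. by rewrite trevalE mmapC. Qed.

Lemma treval_word w : ev (word F w) = wev w.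
Proof. by rewrite trevalE mmapU -[RHS]mul1r; congr (_ * _); exact: rmorph1. Qed.

Lemma treval_var i : ev (var F i) = a i.
Proof. by rewrite treval_word /weval big_seq1. Qed.

Lemma trevalZ p f : ev (p *: f) = pev p *: ev f.
Proof. by rewrite -mul_malgC trevalM trevalC mulr_algl. Qed.

Lemma trevalZC c f : ev (c%:MP *: f) = h c *: ev f.
Proof. by rewrite trevalZ pevalE mmapC. Qed.

Lemma peval_Trw u : u != [::] -> pev (Trw F u) = tr (wev u).
Proof.
move=> u0; rewrite /Trw; case: insubP => [v _ vu|]; last by rewrite u0.
rewrite pevalE mmapU /= rmorph1 mul1r /ceval mdomU big_seq_fset1 cmUU expr1.
rewrite -vu; apply/tr_weval_rot.
by apply/eqmodP; rewrite reprK.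
Qed.

(** The hypothesis cannot be dropped: the term of f at the empty word
    contributes to tr (ev f), but its formal trace is the dummy value 0. *)
Lemma treval_Tr f : no_pure_term f -> ev (Tr f) = (tr (ev f))%:A.
Proof.
move=> f0; rewrite trevalC /Trc; congr (_ *: _).
rewrite pevalE rmorph_sum /= /treval raddf_sum /=.
rewrite !big_seq; apply: eq_bigr => w wf.
rewrite rmorphM linearZ /=; congr (_ * _); apply: peval_Trw.
apply: contraTneq wf => w0; rewrite -mcoeff_eq0; apply/eqP.
by have -> : w = mone by apply/eqP; rewrite fmP fm1 w0.
Qed.

End TrevalTheory.

(** * The formal trace *)

Lemma mmap_central (K : monomType) (R : comNzRingType) (T : K -> R) :
    (forall u v, T (mmul u v) = T (mmul v u)) ->
  forall f g : {malg R[K]}, mmap idfun T (f * g) = mmap idfun T (g * f).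
Proof.
move=> TC f g; rewrite (malgME f g) (malgME g f) !raddf_sum.
under eq_bigr do rewrite raddf_sum; under [RHS]eq_bigr do rewrite raddf_sum.
rewrite [RHS]exchange_big; apply: eq_bigr => u _; apply: eq_bigr => v _ /=.
by rewrite !mmapU TC; congr (_ * _); apply: mulrC.
Qed.

Section FreeTrace.
Local Open Scope quotient_scope.
Variable F : fieldType.
Implicit Types f g : trpoly F.

Lemma TrcE f : Trc f = mmap idfun (fun w : {fmonom nat} => Trw F w) f.
Proof. by []. Qed.

Lemma Trc_scalar : scalar (@Trc F).
Proof.
move=> c f g; rewrite !TrcE raddfD /=; congr (_ + _).
rewrite (mmapEw (msuppZ_le c f)) mmapE mulr_sumr.
by apply: eq_bigr => w _; rewrite mcoeffZ mulrA.
Qed.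

HB.instance Definition _ :=
  GRing.isLinear.Build (puretr F) (trpoly F) (puretr F) *%R (@Trc F) Trc_scalar.

Lemma TrcU c (w : {fmonom nat}) : Trc << c *g w >> = c * Trw F w.
Proof. by rewrite TrcE mmapU. Qed.

Lemma TrwE u (u0 : u != [::]) :
  Trw F u = << ucm (\pi_cycword (exist _ u u0 : nword)) >>.
Proof. by rewrite /Trw (insubT (fun w => w != [::]) u0). Qed.

Lemma Trw_catC u v : Trw F (u ++ v) = Trw F (v ++ u).
Proof.
case: u v => [|x u] [|y v]; rewrite ?cats0 ?cat0s //.
have uv0 : (x :: u) ++ y :: v != [::] by [].
have vu0 : (y :: v) ++ x :: u != [::] by [].
rewrite (TrwE uv0) (TrwE vu0); congr (<< ucm _ >>).
apply/eqmodP/rot_equivP; exists (size (x :: u)).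
by rewrite rot_size_cat.
Qed.

Lemma TrcC f g : Trc (f * g) = Trc (g * f).
Proof. by apply: mmap_central => u v; rewrite !fmM Trw_catC. Qed.
End FreeTrace.

(** * Induction over trace polynomials *)

Section MalgInduction.
Variables (K : monomType) (R : comNzRingType).

Lemma malg_scaleAr (c : R) (f g : {malg R[K]}) : c *: (f * g) = f * (c *: g).
Proof.
rewrite (malgME f g) (malgMEw (fsubset_refl _) (msuppZ_le c g)) scaler_sumr.
apply: eq_bigr => u _; rewrite scaler_sumr; apply: eq_bigr => v _.
rewrite mcoeffZ; apply/malgP => w; rewrite mcoeffZ !mcoeffU.
by rewrite mulrnAr mulrCA.
Qed.

Lemma malgU_mul c (u : K) : << c *g u >> = c%:MP * << u >> :> {malg R[K]}.
Proof.
by rewrite mul_malgC; apply/malgP => w; rewrite mcoeffZ !mcoeffU mulr_natr.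
Qed.

Lemma malg1U_mul u v : << mmul u v >> = << u >> * << v >> :> {malg R[K]}.
Proof. by rewrite malgME !msuppU1 !big_seq_fset1 !mcoeffUU mulr1. Qed.

Lemma malg_ind (P : {malg R[K]} -> Prop) :
    (forall f g, P f -> P g -> P (f + g)) ->
    (forall f g, P f -> P g -> P (f * g)) ->
    (forall c, P c%:MP) -> (forall u, P << u >>) ->
  forall f, P f.
Proof.
move=> PD PM PC PU f; rewrite [f]monalgE; apply: big_ind => //.
  by rewrite -malgC0E.
by move=> u _; rewrite malgU_mul; exact: PM.
Qed.
End MalgInduction.

(** Removing one occurrence of a variable lowers the degree. *)
Lemma cmonom_ind (I : choiceType) (P : {cmonom I} -> Prop) :
  P mone -> (forall i m, P m -> P (mmul (ucm i) m)) -> forall m, P m.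
Proof.
move=> P1 PS m; have [n] := ubnP (mdeg m); elim: n => // n IHn in m *.
have [/mdeg_eq0I -> //|/eqP m0] := eqVneq (mdeg m) 0%N.
have [m1|[i i_m]] := fset_0Vmem (finsupp m).
  by case: m0; rewrite mdegE m1 big_seq_fset0.
have mE : m = mmul (ucm i) (divcm m (ucm i)).
  apply/eqP/cmP => j; rewrite cmM ucmE divcmE ucmE subnKC //.
  by case: eqP => // <-; rewrite lt0n cmE_neq0.
rewrite mE mdegM mdegU add1n ltnS => lt_n.
by apply/PS/IHn.
Qed.

Lemma FMonom_nil : FMonom [::] = mone :> {fmonom nat}.
Proof. by rewrite -[RHS]fmK fm1. Qed.

Lemma FMonom_cat u v :
  FMonom (u ++ v) = mmul (FMonom u) (FMonom v) :> {fmonom nat}.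
Proof. by rewrite -[RHS]fmK fmM. Qed.

Section TrpolyInduction.
Variable F : fieldType.

(** The free algebra with trace is generated over F, as a plain ring, by the
    variables and the traces of words. *)
Lemma trpoly_ind (P : trpoly F -> Prop) :
    (forall f g, P f -> P g -> P (f + g)) ->
    (forall f g, P f -> P g -> P (f * g)) ->
    (forall c : F, P (c%:MP)%:MP) ->
    (forall i, P (var F i)) ->
    (forall u, u != [::] -> P (Tr (word F u))) ->
  forall f, P f.
Proof.
move=> PD PM PC PX PT; apply: malg_ind => // [|[u]]; last first.
  elim: u => [|i u IHu].
    by rewrite FMonom_nil; have := PC 1; rewrite !rmorph1.
  rewrite -cat1s FMonom_cat.
  by rewrite malg1U_mul; exact: (PM _ _ (PX i) IHu).
apply: malg_ind => [p q Pp Pq|p q Pp Pq||m]; last 1 first.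
- elim/cmonom_ind: m => [|c m IHm]; first exact: PC 1.
  rewrite malg1U_mul mpolyCM; apply: (PM _ _ _ IHm).
  have := PT (sval (repr c)) (valP (repr c)).
  (* A trace symbol is the trace of a representative of its cyclic word. *)
  rewrite /Tr /word TrcU mul1r (TrwE F (valP (repr c))).
  suff -> : exist _ (sval (repr c)) (valP (repr c)) = repr c :> nword.
    by rewrite reprK.
  exact: val_inj.
- by rewrite monalgUD; exact: PD.
- rewrite mpolyCM; exact: (PM _ _ Pp Pq).
- exact: PC.
Qed.

Lemma trpoly_morph_eq (B : nzRingType) (h1 h2 : trpoly F -> B) :
    {morph h1 : f g / f + g} -> {morph h2 : f g / f + g} ->
    {morph h1 : f g / f * g} -> {morph h2 : f g / f * g} ->
    (forall c : F, h1 (c%:MP)%:MP = h2 (c%:MP)%:MP) ->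
    (forall i, h1 (var F i) = h2 (var F i)) ->
    (forall u, u != [::] -> h1 (Tr (word F u)) = h2 (Tr (word F u))) ->
  h1 =1 h2.
Proof.
move=> D1 D2 M1 M2 EC EX ET; apply: trpoly_ind => // f g IHf IHg.
  by apply: etrans (D1 f g) (etrans _ (esym (D2 f g))); congr (_ + _).
by apply: etrans (M1 f g) (etrans _ (esym (M2 f g))); congr (_ * _).
Qed.
End TrpolyInduction.

(** * The trace identities of an algebra form a trace T-ideal *)

Section TraceIdentities.
Variables (F : fieldType) (A : traceAlgType F).
Implicit Types (a : nat -> A) (f g : trpoly F).

Definition alg_eval a f : A := treval id (@tralg_tr F A) a f.

Let scalA (c : F) (u v : A) : c *: (u * v) = u * (c *: v) := scalerAr c u v.
Let idF : {rmorphism F -> F} := idfun.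

Lemma alg_eval0 a : alg_eval a 0 = 0.
Proof. exact: (treval0 scalA idF). Qed.

Lemma alg_eval1 a : alg_eval a 1 = 1.
Proof. exact: (treval1 scalA idF). Qed.

Lemma alg_evalD a : {morph alg_eval a : f g / f + g}.
Proof. exact: (trevalD scalA idF). Qed.

Lemma alg_evalB a : {morph alg_eval a : f g / f - g}.
Proof. exact: (trevalB scalA idF). Qed.

Lemma alg_evalM a : {morph alg_eval a : f g / f * g}.
Proof. exact: (trevalM scalA idF). Qed.

Lemma alg_eval_sum a I (r : seq I) P G :
  alg_eval a (\sum_(i <- r | P i) G i) = \sum_(i <- r | P i) alg_eval a (G i).
Proof. exact: (treval_sum scalA idF). Qed.

Lemma alg_eval_prod a I (r : seq I) P G :
  alg_eval a (\prod_(i <- r | P i) G i) = \prod_(i <- r | P i) alg_eval a (G i).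
Proof. exact: (treval_prod scalA idF). Qed.

Lemma alg_eval_var a i : alg_eval a (var F i) = a i.
Proof. exact: (treval_var idF). Qed.

Lemma alg_eval_word a w : alg_eval a (word F w) = weval a w.
Proof. exact: (treval_word idF). Qed.

Lemma alg_evalZC a c f : alg_eval a (c%:MP *: f) = c *: alg_eval a f.
Proof. exact: (trevalZC scalA idF). Qed.

Lemma alg_evalC a c : alg_eval a (c%:MP)%:MP = c%:A.
Proof.
by rewrite -(mulr1 (_%:MP)) mul_malgC alg_evalZC [alg_eval a 1]alg_eval1.
Qed.

Lemma alg_eval_Tr a f :
  no_pure_term f -> alg_eval a (Tr f) = (tralg_tr A (alg_eval a f))%:A.
Proof. exact: (treval_Tr idF (@tralg_trC F A)). Qed.

End TraceIdentities.

Section Substitution.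
Variables (F : fieldType) (s : nat -> trpoly F).
Implicit Types f g : trpoly F.

Let scalT := @malg_scaleAr {fmonom nat} (puretr F).
Let hC : {rmorphism F -> puretr F} := malgC.
Let TrL : {scalar trpoly F} := @Trc F.

Lemma trsubstD : {morph trsubst s : f g / f + g}.
Proof. exact: (trevalD scalT hC TrL). Qed.

Lemma trsubstB : {morph trsubst s : f g / f - g}.
Proof. exact: (trevalB scalT hC TrL). Qed.

Lemma trsubstM : {morph trsubst s : f g / f * g}.
Proof. exact: (trevalM scalT hC TrL). Qed.

Lemma trsubst_prod I (r : seq I) P G :
  trsubst s (\prod_(i <- r | P i) G i) = \prod_(i <- r | P i) trsubst s (G i).
Proof. exact: (treval_prod scalT hC TrL). Qed.

Lemma trsubst_var i : trsubst s (var F i) = s i.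
Proof. exact: (treval_var hC TrL). Qed.

Lemma trsubst_word w : trsubst s (word F w) = weval s w.
Proof. exact: (treval_word hC TrL). Qed.

Lemma trsubstZC c f : trsubst s (c%:MP *: f) = c%:MP *: trsubst s f.
Proof. exact: (trevalZC scalT hC TrL). Qed.

Lemma trsubstC c : trsubst s (c%:MP)%:MP = (c%:MP)%:MP.
Proof.
rewrite -(mulr1 (_%:MP)) mul_malgC trsubstZC.
by rewrite [trsubst s 1](treval1 scalT hC TrL).
Qed.

Lemma trsubst_Tr f : no_pure_term f -> trsubst s (Tr f) = Tr (trsubst s f).
Proof.
move=> f0; rewrite /Tr -[RHS]mulr1 mul_malgC.
exact: (treval_Tr hC (@TrcC F) s f0).
Qed.
End Substitution.

Section NoPureTerm.
Variable F : fieldType.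
Implicit Types (f g : trpoly F) (s : nat -> trpoly F).

Lemma mcoeff_mone_mul (K : monomType) (R : nzRingType) (f g : {malg R[K]}) :
  (f * g)@_mone = f@_mone * g@_mone.
Proof. exact: (rmorphM (@mcoeff K R mone)). Qed.

Lemma no_pure_word u : u != [::] -> no_pure_term (word F u).
Proof.
rewrite /no_pure_term mcoeffU => u0; case: eqP => // uE.
by move: u0; rewrite -[u]/(fmonom_val (FMonom u)) uE fm1.
Qed.

Lemma no_pure_mulr f g : no_pure_term f -> no_pure_term (f * g).
Proof. by rewrite /no_pure_term mcoeff_mone_mul => ->; rewrite mul0r. Qed.

Lemma no_pure_mull f g : no_pure_term g -> no_pure_term (f * g).
Proof. by rewrite /no_pure_term mcoeff_mone_mul => ->; rewrite mulr0. Qed.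

Lemma no_pure_weval s u :
  (forall i, no_pure_term (s i)) -> u != [::] -> no_pure_term (weval s u).
Proof.
by case: u => // i u s0 _; rewrite /weval big_cons; exact: no_pure_mulr.
Qed.
End NoPureTerm.

Section IdIdeal.
Variables (F : fieldType) (A : traceAlgType F).
Implicit Types (a : nat -> A) (f g : trpoly F) (s : nat -> trpoly F).

Lemma alg_eval_weval a s u :
  alg_eval a (weval s u) = weval (fun i => alg_eval a (s i)) u.
Proof. exact: alg_eval_prod. Qed.

(** Substitution followed by evaluation is evaluation at the values of the
    substituted polynomials; both sides are ring morphisms in f, so they need
    only be compared on generators. The hypothesis keeps Tr(s_i1 ... s_im)
    free of the symbol Tr(1), which does not exist. *)
Lemma alg_eval_subst a s f : (forall i, no_pure_term (s i)) ->
  alg_eval a (trsubst s f) = alg_eval (fun i => alg_eval a (s i)) f.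
Proof.
move=> s0; move: f.
apply: (trpoly_morph_eq (h1 := alg_eval a \o trsubst s)).
- by move=> f g; apply: etrans (congr1 _ (trsubstD s f g)) (alg_evalD _ _ _).
- exact: alg_evalD.
- by move=> f g; apply: etrans (congr1 _ (trsubstM s f g)) (alg_evalM _ _ _).
- exact: alg_evalM.
- by move=> c; apply: etrans (congr1 _ (trsubstC s c)) _; rewrite !alg_evalC.
- move=> i; apply: etrans (congr1 _ (trsubst_var s i)) _.
  by rewrite alg_eval_var.
move=> u u0; have wu0 := no_pure_word F u0.
apply: etrans (congr1 _ (trsubst_Tr s wu0)) _.
rewrite trsubst_word (alg_eval_Tr _ (no_pure_weval s0 u0)) (alg_eval_Tr _ wu0).
by rewrite alg_eval_word alg_eval_weval.
Qed.

Lemma Idtr_Ttr_ideal : Ttr_ideal (Idtr A).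
Proof.
split=> [a|f g f0 g0 a|f g g0 a|f g f0 a|s f s0 f0 a|f w w0 f0 a|f fnp f0 a].
- exact: alg_eval0.
- by rewrite [LHS]alg_evalD [X in X + _]f0 [X in _ + X]g0 addr0.
- by rewrite [LHS]alg_evalM [X in _ * X]g0 mulr0.
- by rewrite [LHS]alg_evalM [X in X * _]f0 mul0r.
- by apply: etrans (alg_eval_subst a f s0) _; exact: f0.
- apply: etrans (alg_eval_Tr a (no_pure_mull f (no_pure_word F w0))) _.
  by rewrite alg_evalM [X in X * _]f0 mul0r linear0 scale0r.
apply: etrans (alg_eval_Tr a fnp) _.
by rewrite [alg_eval a f]f0 linear0 scale0r.
Qed.
End IdIdeal.

Lemma Ttr_ideal_gen_ideal (F : fieldType) (G : set (trpoly F)) :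
  Ttr_ideal (Ttr_ideal_gen G).
Proof.
split=> [I [II _]|f g f0 g0 I IG|f g g0 I IG|f g f0 I IG|s f s0 f0 I IG
  |f w w0 f0 I IG|f fnp f0 I IG].
- exact: Ttr_ideal0.
- by apply: (Ttr_idealD IG.1); [apply: f0|apply: g0].
- by apply: (Ttr_idealMl IG.1); apply: g0.
- by apply: (Ttr_idealMr IG.1); apply: f0.
- by apply: (Ttr_ideal_subst IG.1) => //; apply: f0.
- by apply: (Ttr_ideal_TrM IG.1) => //; apply: f0.
by apply: (Ttr_ideal_Tr IG.1) => //; apply: f0.
Qed.

(** * Normal forms modulo an ideal with commutative quotient *)

(** Here R is any ring, I an ideal containing the commutators, and g a family
    of elements. Working with the congruence avoids building the quotient; the
    letters of a word u : seq nat index the factors of [gprod u]. *)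
Section NormalForm.
Variables (F R : nzRingType) (I : R -> Prop).
Hypotheses (I0 : I 0) (ID : forall f g, I f -> I g -> I (f + g)).
Hypotheses (IMl : forall f g, I g -> I (f * g)).
Hypotheses (IMr : forall f g, I f -> I (f * g)).
Hypothesis IC : forall f g, I (f * g - g * f).
Variables (iota : {rmorphism F -> R}) (g : nat -> R).

Definition eq_mod f f' := I (f - f').
Local Notation "f === f'" := (eq_mod f f') (at level 70).

Lemma idealN f : I f -> I (- f).
Proof. by rewrite -mulN1r; exact: IMl. Qed.

Lemma eq_mod_refl f : f === f.
Proof. by rewrite /eq_mod subrr. Qed.

Lemma eq_mod_sym f f' : f === f' -> f' === f.
Proof. by move/idealN; rewrite opprB. Qed.

Lemma eq_mod_trans f1 f2 f3 : f1 === f2 -> f2 === f3 -> f1 === f3.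
Proof. by move=> /ID/[apply]; rewrite addrA subrK. Qed.

Lemma eq_modD f f' h h' : f === f' -> h === h' -> f + h === f' + h'.
Proof. by move=> /ID/[apply]; rewrite /eq_mod opprD addrACA. Qed.

Lemma eq_modMl h f f' : f === f' -> h * f === h * f'.
Proof. by move=> /(IMl h); rewrite mulrBr. Qed.

Lemma eq_modMr h f f' : f === f' -> f * h === f' * h.
Proof. by move=> /(IMr h); rewrite mulrBl. Qed.

Lemma eq_modM f f' h h' : f === f' -> h === h' -> f * h === f' * h'.
Proof. by move=> /(eq_modMr h) E /(eq_modMl f'); exact: eq_mod_trans. Qed.

Lemma ideal_eq_mod f f' : f === f' -> I f' -> I f.
Proof. by move=> /ID/[apply]; rewrite subrK. Qed.

Lemma ideal_sum (J : eqType) (r : seq J) (P : pred J) (G : J -> R) :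
  (forall j, j \in r -> P j -> I (G j)) -> I (\sum_(j <- r | P j) G j).
Proof.
by move=> IG; rewrite big_seq_cond; apply: big_ind => // j /andP[]; exact: IG.
Qed.

Lemma eq_mod_sum (J : eqType) (r : seq J) (P : pred J) (G H : J -> R) :
    (forall j, j \in r -> P j -> G j === H j) ->
  \sum_(j <- r | P j) G j === \sum_(j <- r | P j) H j.
Proof. by move=> GH; rewrite /eq_mod -sumrB; exact: ideal_sum. Qed.

Definition gprod (u : seq nat) : R := \prod_(j <- u) g j.

Lemma gprod_cat u v : gprod (u ++ v) = gprod u * gprod v.
Proof. by rewrite /gprod big_cat. Qed.

Lemma gprod_perm u v : perm_eq u v -> gprod u === gprod v.
Proof.
move=> uv; apply: (@catCA_perm_ind _ (fun v => gprod u === gprod v)) uv _ => /=.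
  move=> s1 s2 s3; rewrite !gprod_cat => /eq_mod_trans; apply.
  by rewrite !mulrA; exact/eq_modMr/IC.
exact: eq_mod_refl.
Qed.

(** The words of s need not be distinct, nor distinct up to permutation: lists
    are closed under concatenation, and like terms are collected only once, in
    [lincomb_ideal]. *)
Definition lincomb (s : seq (F * seq nat)) : R :=
  \sum_(x <- s) iota x.1 * gprod x.2.

Definition has_nf f := exists s, f === lincomb s.

Lemma has_nf_eq_mod f f' : f === f' -> has_nf f' -> has_nf f.
Proof. by move=> ff' [s f's]; exists s; exact: eq_mod_trans f's. Qed.

Lemma has_nfD f f' : has_nf f -> has_nf f' -> has_nf (f + f').
Proof.
move=> [s fs] [s' f's']; exists (s ++ s').
by rewrite /lincomb big_cat; exact: eq_modD.
Qed.

Lemma has_nfM f f' : has_nf f -> has_nf f' -> has_nf (f * f').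
Proof.
move=> [s fs] [s' f's'].
exists [seq (x.1 * y.1, x.2 ++ y.2) | x <- s, y <- s'].
apply: eq_mod_trans (eq_modM fs f's') _.
rewrite /lincomb big_allpairs_dep mulr_suml; apply: eq_mod_sum => x _ _.
rewrite mulr_sumr; apply: eq_mod_sum => y _ _ /=.
rewrite rmorphM gprod_cat -!mulrA; apply: eq_modMl.
by rewrite !mulrA; exact/eq_modMr/IC.
Qed.

Lemma has_nfC c : has_nf (iota c).
Proof.
exists [:: (c, [::])]; rewrite /lincomb big_seq1 /gprod big_nil mulr1.
exact: eq_mod_refl.
Qed.

Lemma has_nf_gen j : has_nf (g j).
Proof.
exists [:: (1, [:: j])].
by rewrite /lincomb big_seq1 /gprod big_seq1 rmorph1 mul1r; exact: eq_mod_refl.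
Qed.

(** Grouping the terms by weight: terms of equal weight have congruent
    products, so each group is congruent to the sum of its coefficients times
    one product, and one of these two factors kills it. *)
Lemma lincomb_ideal (wt : seq nat -> nat) s :
    (forall x y, x \in s -> y \in s -> wt x.2 = wt y.2 ->
       gprod x.2 === gprod y.2) ->
    (forall x, x \in s ->
       I (gprod x.2) \/ \sum_(y <- s | wt y.2 == wt x.2) y.1 = 0) ->
  I (lincomb s).
Proof.
move=> wtP zP; pose N := \max_(x <- s) wt x.2.
have wt_le x : x \in s -> (wt x.2 <= N)%N by move=> xs; exact: leq_bigmax_seq.
rewrite /lincomb (partition_big (fun x => inord (wt x.2) : 'I_N.+1) xpredT) //=.
apply: ideal_sum => e _ _; rewrite big_seq_cond.
have eE x : (x \in s) && (inord (wt x.2) == e) = (x \in s) && (wt x.2 == e).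
  case: (boolP (x \in s)) => //= xs.
  by rewrite -val_eqE /= inordK // ltnS wt_le.
rewrite (eq_bigl _ _ eE) -big_seq_cond.
have [/hasP[x xs /eqP wx]|/hasPn no] := boolP (has (fun x => wt x.2 == e) s).
  have cls y : y \in s -> wt y.2 == e ->
      iota y.1 * gprod y.2 === iota y.1 * gprod x.2.
    by move=> ys /eqP wy; apply/eq_modMl/wtP => //; rewrite wx.
  apply: ideal_eq_mod (eq_mod_sum cls) _; rewrite -mulr_suml -rmorph_sum -wx.
  by case: (zP x xs) => [|->]; [exact: IMl|rewrite rmorph0 mul0r].
by rewrite big_seq_cond big1 // => x /andP[xs]; rewrite (negbTE (no x xs)).
Qed.
End NormalForm.

Lemma malgC_central (K : monomType) (R : comNzRingType) (p : R)
  (f : {malg R[K]}) : f * p%:MP = p%:MP * f.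
Proof.
have -> : p%:MP = p *: 1 :> {malg R[K]} by rewrite -mul_malgC mulr1.
by rewrite -malg_scaleAr -scalerAl mulr1 mul1r.
Qed.

(** The elements whose commutator with g lies in I form a subring, so that
    commutators need only be checked on generators. *)
Section CommutatorIdeal.
Variables (R : nzRingType) (I : R -> Prop).
Hypotheses (ID : forall f g, I f -> I g -> I (f + g)).
Hypotheses (IMl : forall f g, I g -> I (f * g)).
Hypotheses (IMr : forall f g, I f -> I (f * g)).

Lemma commutator_idealD g f f' :
  I (f * g - g * f) -> I (f' * g - g * f') -> I ((f + f') * g - g * (f + f')).
Proof. by move=> /ID/[apply]; rewrite mulrDl mulrDr opprD addrACA. Qed.

Lemma commutator_idealM g f f' :
  I (f * g - g * f) -> I (f' * g - g * f') -> I (f * f' * g - g * (f * f')).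
Proof.
move=> /(IMr f') + /(IMl f); rewrite mulrBl mulrBr => /ID/[apply].
by rewrite !mulrA addrC subrKA.
Qed.

Lemma commutator_ideal_sym g f : I (f * g - g * f) -> I (g * f - f * g).
Proof. by move=> /(IMl (-1)); rewrite mulN1r opprB. Qed.

End CommutatorIdeal.

(** * Consequences of the generators in a trace T-ideal *)

Section GeneratorSubstitution.
Variables (F : fieldType) (s : nat -> trpoly F).

Lemma no_pure_var i : no_pure_term (var F i).
Proof. exact: no_pure_word. Qed.

Lemma word_cat u v : word F (u ++ v) = word F u * word F v.
Proof. by rewrite /word FMonom_cat malg1U_mul. Qed.

Lemma trsubst_mul_var i j : trsubst s (var F i * var F j) = s i * s j.
Proof.
apply: etrans (trsubstM s _ _) _.
exact: (congr2 *%R (trsubst_var s i) (trsubst_var s j)).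
Qed.

Lemma trsubst_Tr_var i : trsubst s (Tr (var F i)) = Tr (s i).
Proof.
apply: etrans (trsubst_Tr s (no_pure_var i)) _.
exact: (congr1 (@Tr F) (trsubst_var s i)).
Qed.

Lemma trsubst_f1 : trsubst s (f1 F) = s 0 * s 1 - s 1 * s 0.
Proof.
apply: etrans (trsubstB s _ _) _.
exact: (congr2 (fun f g => f - g) (trsubst_mul_var 0 1) (trsubst_mul_var 1 0)).
Qed.

Lemma trsubst_g6 alpha :
  trsubst s (g6 alpha) = Tr (s 0) * Tr (s 1) - alpha%:MP *: Tr (s 0 * s 1).
Proof.
apply: etrans (trsubstB s _ _) _; apply: (congr2 (fun f g => f - g)).
  apply: etrans (trsubstM s _ _) _.
  exact: (congr2 *%R (trsubst_Tr_var 0) (trsubst_Tr_var 1)).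
apply: etrans (trsubstZC s _ _) _; apply: (congr1 (fun f => _ *: f)).
apply: etrans (trsubst_Tr s _) _; first exact/no_pure_mulr/no_pure_var.
exact: (congr1 (@Tr F) (trsubst_mul_var 0 1)).
Qed.

Lemma trsubst_g7 alpha k :
  trsubst s (g7 alpha k) = \prod_(i < k) (Tr (s i) - alpha%:MP *: s i).
Proof.
apply: etrans (trsubst_prod s _ _ _) _; apply: eq_bigr => i _.
apply: etrans (trsubstB s _ _) _; apply: (congr2 (fun f g => f - g)).
  exact: trsubst_Tr_var.
apply: etrans (trsubstZC s _ _) _; apply: (congr1 (fun f => _ *: f)).
exact: trsubst_var.
Qed.
End GeneratorSubstitution.

(** The elements y_i = Tr(x_i) and z_i = Tr(x_i) - alpha x_i as one family: the
    letter 2i stands for y_i and the letter 2i+1 for z_i, so that the number of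
    odd letters of a word is its degree in the z_i. *)
Definition nilgen (F : fieldType) (alpha : F) (j : nat) : trpoly F :=
  if odd j then Tr (var F j./2) - alpha%:MP *: var F j./2 else Tr (var F j./2).

Section ModuloGenerators.
Variables (F : fieldType) (alpha : F) (k : nat).
Hypothesis alpha_neq0 : alpha != 0.
Variable I : set (trpoly F).
Hypothesis II : Ttr_ideal I.
Hypotheses (If1 : I (f1 F)) (Ig6 : I (g6 alpha)) (Ig7 : I (g7 alpha k)).

Let I0 := Ttr_ideal0 II.
Let ID := Ttr_idealD II.
Let IMl := Ttr_idealMl II.
Let IMr := Ttr_idealMr II.

Lemma Ttr_ideal_var_comm i j : I (var F i * var F j - var F j * var F i).
Proof.
pose s n := var F (if n is 0%N then i else j).
have s0 n : no_pure_term (s n) by exact: no_pure_var.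
have := Ttr_ideal_subst II s0 If1.
by rewrite (trsubst_f1 s).
Qed.

(** Constants and traces are central, hence f1 is enough; the reduction to
    variables is made in the first argument, then in the second one. *)
Lemma Ttr_ideal_comm f g : I (f * g - g * f).
Proof.
have base p h : I (p%:MP * h - h * p%:MP).
  by rewrite malgC_central subrr.
have ind h : (forall i, I (var F i * h - h * var F i)) ->
    forall f, I (f * h - h * f).
  move=> IX; elim/trpoly_ind => [p q|p q|c|//|u _]; try exact: base.
    exact: commutator_idealD.
  exact: commutator_idealM.
apply: (ind g) => i.
have C := ind (var F i) (fun j => Ttr_ideal_var_comm j i) g.
exact: (commutator_ideal_sym IMl C).
Qed.

Lemma Ttr_ideal_Tr_mul u v : u != [::] -> v != [::] ->
  I (Tr (word F u) * Tr (word F v) - alpha%:MP *: Tr (word F (u ++ v))).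
Proof.
move=> u0 v0; pose s n := word F (if n is 0%N then u else v).
have s0 n : no_pure_term (s n) by case: n => [|n]; exact: no_pure_word.
have := Ttr_ideal_subst II s0 Ig6.
by rewrite (trsubst_g6 s) /s -word_cat.
Qed.

Let iota : {rmorphism F -> trpoly F} := malgC \o malgC.
Let gen := nilgen alpha.
Local Notation nf := (has_nf I iota gen).

Let IC := Ttr_ideal_comm.
Let nfD f g : nf f -> nf g -> nf (f + g) := has_nfD ID (f' := g).
Let nfM f g : nf f -> nf g -> nf (f * g) := has_nfM I0 ID IMl IMr IC (f' := g).
Let nfC c : nf (c%:MP)%:MP := has_nfC I0 iota gen c.

Lemma scalar_inv (f : trpoly F) : (alpha^-1%:MP)%:MP * (alpha%:MP *: f) = f.
Proof. by rewrite mul_malgC scalerA -mpolyCM mulVf // mpolyC1E scale1r. Qed.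

(** Up to the factor 1/alpha, x_i is y_i - z_i. *)
Lemma varE i :
  var F i = ((- alpha^-1)%:MP)%:MP * (Tr (var F i) - alpha%:MP *: var F i)
            + (alpha^-1%:MP)%:MP * Tr (var F i).
Proof.
rewrite !monalgUN mulNr -mulrN -mulrDr opprB subrK.
by rewrite scalar_inv.
Qed.

Lemma has_nf_Tr_var i : nf (Tr (var F i)).
Proof.
by have := has_nf_gen I0 iota gen i.*2; rewrite /gen /nilgen odd_double doubleK.
Qed.

Lemma has_nf_var i : nf (var F i).
Proof.
have nfz : nf (Tr (var F i) - alpha%:MP *: var F i).
  have := has_nf_gen I0 iota gen i.*2.+1.
  by rewrite /gen /nilgen /= odd_double uphalf_double.
by rewrite varE; apply/nfD/nfM/has_nf_Tr_var/nfC; apply: nfM.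
Qed.

Lemma has_nf_Tr_word u : u != [::] -> nf (Tr (word F u)).
Proof.
elim: u => // i [|j u] IHu _; first exact: has_nf_Tr_var.
have {}IHu := IHu isT.
have E : eq_mod I (Tr (word F [:: i, j & u]))
                  ((alpha^-1%:MP)%:MP * (Tr (var F i) * Tr (word F (j :: u)))).
  have := @Ttr_ideal_Tr_mul [:: i] (j :: u) isT isT.
  move/(eq_modMl IMl (alpha^-1%:MP)%:MP) => E.
  exact: (eq_mod_sym IMl (eq_ind _ (eq_mod I _) E _ (scalar_inv _))).
exact: (has_nf_eq_mod ID E (nfM (nfC _) (nfM (has_nf_Tr_var i) IHu))).
Qed.

Lemma all_has_nf f : nf f.
Proof.
elim/trpoly_ind: f => [f g|f g|c|i|u].
- exact: nfD.
- exact: nfM.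
- exact: nfC.
- exact: has_nf_var.
exact: has_nf_Tr_word.
Qed.

(** Modulo I the factors may be permuted so as to put k of the z_i in front,
    and their product is a substitution of g7. *)
Lemma gprod_nilgen_ideal u : (k <= count odd u)%N -> I (gprod gen u).
Proof.
rewrite -size_filter => le_k; pose v := take k (seq.filter odd u).
have sz_v : size v = k by rewrite size_take_min; apply/minn_idPl.
have odd_v : all odd v.
  by apply/allP => j /mem_take; rewrite mem_filter => /andP[].
have Iv : I (gprod gen v).
  pose s i := var F (nth 0 v i)./2.
  have s0 i : no_pure_term (s i) by exact: no_pure_var.
  have := Ttr_ideal_subst II s0 Ig7; rewrite (trsubst_g7 s).
  rewrite /gprod (big_nth 0%N) sz_v big_mkord.
  suff -> : \prod_(i < k) gen (nth 0%N v i)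
            = \prod_(i < k) (Tr (s i) - alpha%:MP *: s i) by [].
  apply: eq_bigr => i _; rewrite /gen /nilgen.
  suff -> : odd (nth 0%N v i) by [].
  by apply: (allP odd_v); apply: mem_nth; rewrite sz_v.
have uE : perm_eq u
    (v ++ (drop k (seq.filter odd u) ++ seq.filter (predC odd) u)).
  by rewrite catA cat_take_drop perm_sym perm_filterC.
apply: (ideal_eq_mod ID (gprod_perm I0 ID IMr IC gen uE)).
by rewrite gprod_cat; exact: IMr.
Qed.

End ModuloGenerators.

(** * Separating monomials by a weight *)

Lemma base_digits_inj N L (d e : nat -> nat) :
    (forall i, d i < N)%N -> (forall i, e i < N)%N ->
    (\sum_(i < L) d i * N ^ i = \sum_(i < L) e i * N ^ i)%N ->
  forall i, (i < L)%N -> d i = e i.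
Proof.
elim: L d e => // L IHL d e dN eN; rewrite !big_ord_recl !expn0 !muln1 => E.
have shift (c : nat -> nat) :
    (\sum_(i < L) c (lift ord0 i) * N ^ lift ord0 i
      = N * \sum_(i < L) c i.+1 * N ^ i)%N.
  by rewrite big_distrr; apply: eq_bigr => i _ /=; rewrite expnS mulnCA.
have {}E : (d 0 + N * (\sum_(i < L) d i.+1 * N ^ i)
            = e 0 + N * \sum_(i < L) e i.+1 * N ^ i)%N.
  by rewrite -!shift.
have N0 : (0 < N)%N by exact: leq_ltn_trans (dN 0%N).
have E0 : d 0%N = e 0%N.
  have := congr1 (modn^~ N) E.
  by rewrite /= !(addnC _ (N * _)%N) !(mulnC N) !modnMDl !modn_small.
move: E; rewrite E0 => /addnI/eqP; rewrite eqn_pmul2l // => /eqP E [//|i].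
rewrite ltnS; apply: (IHL (d \o succn) (e \o succn)) => // j.
  exact: dN.
exact: eN.
Qed.

(** The exponents of the monomial u, read as digits in base N. *)
Definition weight N (u : seq nat) := (\sum_(j <- u) N ^ j)%N.

Lemma weight_count N L u : all (fun j => j < L)%N u ->
  weight N u = (\sum_(i < L) count_mem (i : nat) u * N ^ i)%N.
Proof.
rewrite /weight; elim: u => [|j u IHu] /=.
  by rewrite big_nil big1.
case/andP=> jL /IHu {}IHu; rewrite big_cons IHu.
under [RHS]eq_bigr do rewrite mulnDl.
rewrite big_split /=; congr addn; rewrite (bigD1 (Ordinal jL)) //= eqxx mul1n.
by rewrite big1 ?addn0 // => i; rewrite eq_sym -val_eqE /= => /negbTE ->.
Qed.

Lemma weight_inj N u v : (size u < N)%N -> (size v < N)%N ->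
  weight N u = weight N v -> perm_eq u v.
Proof.
move=> uN vN; pose L := (\max_(j <- u ++ v) j).+1.
have: all (fun j => j < L)%N (u ++ v).
  by apply/allP => j j_uv; rewrite ltnS; exact: leq_bigmax_seq.
rewrite all_cat => /andP[uL vL].
rewrite (weight_count N uL) (weight_count N vL).
have small (w : seq nat) : (size w < N)%N -> forall i, (count_mem i w < N)%N.
  by move=> wN i; exact: leq_ltn_trans (count_size _ _) wN.
move/(base_digits_inj (d := fun i => count_mem i u)
        (e := fun i => count_mem i v) (small u uN) (small v vN)) => E.
apply/allP => j; rewrite mem_cat => j_uv; apply/eqP; apply: E.
by case/orP: j_uv; [move/(allP uL)|move/(allP vL)].
Qed.

Lemma poly_pchar0_eq0 (F : fieldType) (p : {poly F}) : [pchar F] =i pred0 ->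
  (forall s, p.[s] = 0) -> p = 0.
Proof.
move=> /pcharf0P F0 p0; apply/eqP; apply: contraFT (ltnn (size p)) => p_neq0.
pose rs : seq F := [seq i%:R | i <- iota 0 (size p)].
have := max_poly_roots p_neq0 (rs := rs); rewrite /rs size_map size_iota; apply.
  by apply/allP => x _; apply/eqP.
rewrite map_inj_in_uniq ?iota_uniq // => i j _ _.
wlog le_ij : i j / (i <= j)%N.
  by move=> H; case: (leqP i j) => [/H//|/ltnW/H ji /esym/ji].
move/esym/eqP; rewrite -subr_eq0 -natrB // F0 subn_eq0 => le_ji.
by apply/eqP; rewrite eqn_leq le_ij.
Qed.

(** * The algebra of Toeplitz matrices *)

Section Toeplitz.
Variables (F : fieldType) (k : nat).
Local Notation A := (toeplitz_alg F k).
Local Notation m := k.-1.+1.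

Lemma toeplitz_shift_subproof :
  \matrix_(i < m, j < m) (j == i.+1 :> nat)%:R \is a @toeplitz F k.
Proof.
apply/toeplitz_entriesP; exists (fun d => (d == 1%N)%:R) => i j; rewrite mxE.
case: leqP => [ij|ji]; last by rewrite ltn_eqF // ltnW.
by rewrite -[in RHS](eqn_add2r i) subnK // add1n.
Qed.

Definition toeplitz_shift : A := ToeplitzAlg toeplitz_shift_subproof.
Local Notation t := toeplitz_shift.

Lemma toeplitz_shiftX d (i j : 'I_m) :
  toeplitz_val (t ^+ d) i j = (j == i + d :> nat)%N%:R.
Proof.
elim: d i j => [|d IHd] i j.
  by rewrite expr0 mxE addn0 -val_eqE eq_sym.
rewrite exprS mxE.
under eq_bigr => l _ do rewrite mxE IHd.
have [lt_im|le_mi] := ltnP i.+1 m.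
  rewrite (bigD1 (Ordinal lt_im)) //= eqxx mul1r addSnnS big1 ?addr0 // => l.
  by rewrite -val_eqE /= => /negbTE ->; rewrite mul0r.
rewrite big1 => [|l _]; last first.
  by rewrite ltn_eqF ?mul0r //; apply: leq_trans (ltn_ord l) _.
rewrite ltn_eqF // (leq_trans (ltn_ord j)) // (leq_trans le_mi) //.
by rewrite addnS ltnS leq_addr.
Qed.

Lemma toeplitz_entry0 (M : A) (i j : 'I_m) : (i <= j)%N ->
  toeplitz_val M i j = toeplitz_val M ord0 (inord (j - i)).
Proof.
move=> ij; have /toeplitz_entriesP[a aE] := valP M.
by rewrite !aE ij subn0 inordK // (leq_ltn_trans (leq_subr _ _)).
Qed.

(** The shift generates the algebra, so that commutativity and divisibility
    questions can be settled in F[X]. *)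
Lemma toeplitz_horner (M : A) :
  M = horner_alg t (\poly_(d < m) toeplitz_val M ord0 (inord d)).
Proof.
rewrite poly_def rmorph_sum; apply: val_inj; apply/matrixP => i j.
rewrite [RHS](_ : _ = \sum_(d < m)
    toeplitz_val M ord0 d * (j == i + d :> nat)%N%:R); last first.
  rewrite raddf_sum summxE; apply: eq_bigr => d _.
  rewrite -mul_polyC rmorphM /= horner_algC rmorphXn /= horner_algX mulr_algl.
  rewrite -[LHS]/((_ *: toeplitz_val (t ^+ d)) i j).
  by rewrite mxE toeplitz_shiftX inord_val.
rewrite -[LHS]/(toeplitz_val M i j).
have [ij|ji] := leqP i j; last first.
  rewrite big1 => [|d _].
    by have /toeplitz_entriesP[a ->] := valP M; rewrite leqNgt ji.
  by rewrite ltn_eqF ?mulr0 // (leq_trans ji) // leq_addr.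
rewrite (bigD1 (inord (j - i))) //= inordK ?(leq_ltn_trans (leq_subr _ _)) //.
rewrite subnKC // eqxx mulr1 -toeplitz_entry0 // big1 ?addr0 // => d.
rewrite -val_eqE /= inordK ?(leq_ltn_trans (leq_subr _ _)) // => neq.
rewrite (_ : _ == _ = false) ?mulr0 //; apply: contraNF neq => /eqP ->.
by rewrite addKn.
Qed.

Lemma toeplitz_mulC (M N : A) : M * N = N * M.
Proof. by rewrite (toeplitz_horner M) (toeplitz_horner N) -!rmorphM mulrC. Qed.

Definition toeplitz_diag (M : A) : F := toeplitz_val M ord0 ord0.

Lemma toeplitz_diagM (M N : A) :
  toeplitz_diag (M * N) = toeplitz_diag M * toeplitz_diag N.
Proof.
rewrite /toeplitz_diag mxE big_ord_recl big1 ?addr0 // => i _.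
by have /toeplitz_entriesP[d ->] := valP N; rewrite mulr0.
Qed.

(** A polynomial without constant term is a multiple of 'X. *)
Lemma toeplitz_nil (M : A) : exists N : A, M - (toeplitz_diag M)%:A = t * N.
Proof.
pose p := \poly_(d < m) toeplitz_val M ord0 (inord d).
have p0 : p`_0 = toeplitz_diag M.
  rewrite coef_poly /toeplitz_diag; congr (toeplitz_val M ord0 _).
  by apply: val_inj; rewrite /= inordK.
exists (horner_alg t (p %/ 'X)).
have -> : t * horner_alg t (p %/ 'X) = horner_alg t ('X * (p %/ 'X)).
  by rewrite rmorphM /= horner_algX.
have -> : 'X * (p %/ 'X) = p - (p`_0)%:P.
  have modE : p %% 'X = (p`_0)%:P.
    by rewrite -['X]subr0 -polyC0 modp_XsubC horner_coef0.
  by apply/esym/eqP; rewrite subr_eq -modE mulrC -divp_eq.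
by rewrite rmorphB /= horner_algC p0 -toeplitz_horner.
Qed.

Lemma toeplitz_nil_prod (I : Type) (r : seq I) (P : pred I) (M : I -> A) :
    (0 < k <= count P r)%N ->
  \prod_(i <- r | P i) (M i - (toeplitz_diag (M i))%:A) = 0.
Proof.
case/andP=> k0 le_k.
have [N ->] : exists N, \prod_(i <- r | P i) (M i - (toeplitz_diag (M i))%:A)
    = t ^+ count P r * N.
  elim: r {le_k} => [|i r [N IHr]] /=; first by exists 1; rewrite big_nil mulr1.
  rewrite big_cons; case: (P i); last by exists N.
  have [N' ->] := toeplitz_nil (M i); exists (N' * N).
  rewrite IHr add1n exprS -!mulrA; congr (_ * _).
  by rewrite !mulrA (toeplitz_mulC N').
suff -> : t ^+ count P r = 0 by rewrite mul0r.
apply: val_inj; apply/matrixP => i j; rewrite toeplitz_shiftX mxE.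
have le_m : (m <= count P r)%N by rewrite prednK.
by rewrite ltn_eqF // (leq_trans (ltn_ord j)) // (leq_trans le_m) // leq_addl.
Qed.

End Toeplitz.

(** * The trace identities of the Toeplitz algebra *)

Section GeneratorEvaluation.
Variables (F : fieldType) (A : traceAlgType F) (a : nat -> A).

Lemma alg_eval_Tr_var i : alg_eval a (Tr (var F i)) = (tralg_tr A (a i))%:A.
Proof.
apply: etrans (alg_eval_Tr a (no_pure_var F i)) _.
by rewrite alg_eval_var.
Qed.

Lemma alg_eval_nilpart alpha i :
  alg_eval a (Tr (var F i) - alpha%:MP *: var F i)
    = (tralg_tr A (a i))%:A - alpha *: a i.
Proof.
apply: etrans (alg_evalB a _ _) _; apply: (congr2 (fun u v => u - v)).
  exact: alg_eval_Tr_var.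
by apply: etrans (alg_evalZC a _ _) _; rewrite alg_eval_var.
Qed.

Lemma alg_eval_mul_var i j : alg_eval a (var F i * var F j) = a i * a j.
Proof.
apply: etrans (alg_evalM a _ _) _.
exact: (congr2 *%R (alg_eval_var a i) (alg_eval_var a j)).
Qed.

Lemma alg_eval_f1 : alg_eval a (f1 F) = a 0 * a 1 - a 1 * a 0.
Proof.
apply: etrans (alg_evalB a _ _) _.
apply: (congr2 (fun u v => u - v)); exact: alg_eval_mul_var.
Qed.

Lemma alg_eval_g6 alpha : alg_eval a (g6 alpha)
  = (tralg_tr A (a 0) * tralg_tr A (a 1) - alpha * tralg_tr A (a 0 * a 1))%:A.
Proof.
apply: etrans (alg_evalB a _ _) _; rewrite scalerBl.
apply: (congr2 (fun u v => u - v)).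
  apply: etrans (alg_evalM a _ _) _.
  apply: etrans (congr2 *%R (alg_eval_Tr_var 0) (alg_eval_Tr_var 1)) _.
  by rewrite mulr_algl scalerA.
apply: etrans (alg_evalZC a _ _) _; rewrite -scalerA; congr (_ *: _).
apply: etrans (alg_eval_Tr a _) _; first exact/no_pure_mulr/no_pure_var.
by rewrite alg_eval_mul_var.
Qed.

Lemma alg_eval_g7 alpha k : alg_eval a (g7 alpha k)
  = \prod_(i < k) ((tralg_tr A (a i))%:A - alpha *: a i).
Proof.
apply: etrans (alg_eval_prod a _ _ _) _.
by apply: eq_bigr => i _; exact: alg_eval_nilpart.
Qed.

Lemma alg_eval_nilgen alpha j : alg_eval a (nilgen alpha j)
  = if odd j then (tralg_tr A (a j./2))%:A - alpha *: a j./2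
    else (tralg_tr A (a j./2))%:A.
Proof.
rewrite /nilgen; case: ifP => _; first exact: alg_eval_nilpart.
exact: alg_eval_Tr_var.
Qed.

Lemma alg_eval_lincomb (iota : {rmorphism F -> trpoly F}) g s :
    (forall c, iota c = (c%:MP)%:MP) ->
  alg_eval a (lincomb iota g s)
    = \sum_(x <- s) x.1 *: \prod_(j <- x.2) alg_eval a (g j).
Proof.
move=> iotaE; apply: etrans (alg_eval_sum a _ _ _) _; apply: eq_bigr => x _.
apply: etrans (alg_evalM a _ _) _; rewrite iotaE alg_evalC mulr_algl.
by congr (_ *: _); exact: alg_eval_prod.
Qed.
End GeneratorEvaluation.

Section ToeplitzIdentities.
Variables (F : fieldType) (charF0 : [pchar F] =i pred0).
Variables (alpha : F) (alpha_neq0 : alpha != 0) (k : nat) (k_gt0 : (0 < k)%N).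
Local Notation A := (toeplitz_tralg k alpha).
Local Notation t := (toeplitz_shift F k).

Lemma toeplitz_trE (M : toeplitz_alg F k) :
  tralg_tr A M = alpha * toeplitz_diag M.
Proof. by []. Qed.

(** This puts z_i in the form of [toeplitz_nil_prod]. *)
Lemma toeplitz_nilpart (M : toeplitz_alg F k) :
  (tralg_tr A M)%:A - alpha *: M
    = (- alpha) *: M - (toeplitz_diag ((- alpha) *: M))%:A.
Proof.
rewrite toeplitz_trE.
have -> : toeplitz_diag (- alpha *: M) = - alpha * toeplitz_diag M.
  by rewrite /toeplitz_diag mxE.
by rewrite mulNr !scaleNr opprK addrC.
Qed.

Lemma toeplitz_nilpart_prod (I : Type) (r : seq I) (P : pred I)
    (M : I -> toeplitz_alg F k) : (k <= count P r)%N ->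
  \prod_(i <- r | P i) ((tralg_tr A (M i))%:A - alpha *: M i) = 0.
Proof.
move=> le_k; under eq_bigr do rewrite toeplitz_nilpart.
by rewrite toeplitz_nil_prod // k_gt0.
Qed.

Lemma Idtr_f1 : Idtr A (f1 F).
Proof.
move=> a; apply: etrans (alg_eval_f1 a) _.
by rewrite (toeplitz_mulC (a 0) (a 1)) subrr.
Qed.

Lemma Idtr_g6 : Idtr A (g6 alpha).
Proof.
move=> a; apply: etrans (alg_eval_g6 a alpha) _.
rewrite !toeplitz_trE toeplitz_diagM [X in X - _]mulrACA -!mulrA subrr.
exact: scale0r.
Qed.

Lemma Idtr_g7 : Idtr A (g7 alpha k).
Proof.
move=> a; apply: etrans (alg_eval_g7 a alpha k) _.
by apply: toeplitz_nilpart_prod; rewrite -sum1_count sum1_card card_ord.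
Qed.

Section Kronecker.
Variables (N : nat) (s : F).

(** The factor 1/alpha makes the values of y_i and z_i exactly s^(N^(2i)) and
    s^(N^(2i+1)) t. *)
Definition kronecker_point (i : nat) : toeplitz_alg F k :=
  alpha^-1 *: ((s ^+ (N ^ i.*2))%:A - s ^+ (N ^ i.*2.+1) *: t).

Lemma kronecker_nilgen j :
  alg_eval (kronecker_point : nat -> A) (nilgen alpha j)
    = s ^+ (N ^ j) *: t ^+ odd j.
Proof.
have trE i : tralg_tr A (kronecker_point i) = s ^+ (N ^ i.*2).
  rewrite toeplitz_trE /toeplitz_diag !mxE /=.
  by rewrite mulr0 subr0 mulr1 mulrA mulfV // mul1r.
have jE := odd_double_half j.
rewrite alg_eval_nilgen trE; case: (odd j) jE => jE.
  rewrite -[in RHS]jE add1n expr1 /kronecker_point scalerA mulfV // scale1r.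
  by rewrite opprB addrC subrK.
by rewrite -[in RHS]jE add0n expr0.
Qed.

Lemma kronecker_lincomb (iota : {rmorphism F -> trpoly F}) u :
    (forall c, iota c = (c%:MP)%:MP) ->
  alg_eval (kronecker_point : nat -> A) (lincomb iota (nilgen alpha) u)
    = \sum_(x <- u) (x.1 * s ^+ weight N x.2) *: t ^+ count odd x.2.
Proof.
move=> /alg_eval_lincomb ->; apply: eq_bigr => x _.
rewrite -scalerA; congr (_ *: _); elim: x.2 => [|j v IHv].
  by rewrite big_nil /weight big_nil expr0 scale1r.
rewrite big_cons IHv kronecker_nilgen -scalerAl -scalerAr scalerA -exprD.
by rewrite -exprD /weight big_cons.
Qed.
End Kronecker.

(** The coefficient of t^d in the value of the linear combination is a
    polynomial p in s with p = 0, as F is infinite; the displayed sum is its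
    coefficient of degree e. *)
Lemma Idtr_lincomb_coef N (iota : {rmorphism F -> trpoly F}) u d e :
    (forall c, iota c = (c%:MP)%:MP) -> (d < k)%N ->
    Idtr A (lincomb iota (nilgen alpha) u) ->
  \sum_(x <- u | (count odd x.2 == d) && (weight N x.2 == e)) x.1 = 0.
Proof.
move=> iotaE lt_dk u0.
pose p := \sum_(x <- u | count odd x.2 == d) x.1 *: 'X^(weight N x.2).
suff p0 : p = 0.
  have := congr1 (fun q : {poly F} => q`_e) p0.
  rewrite coef0 => pe; rewrite -[RHS]pe /p coef_sum big_mkcondr.
  apply: eq_bigr => x _.
  by rewrite coefZ coefXn eq_sym; case: eqP; rewrite ?mulr1 ?mulr0.
apply: (poly_pchar0_eq0 charF0) => s.
have := u0 (kronecker_point N s : nat -> A).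
move/(etrans (esym (kronecker_lincomb N s u iotaE))).
move/(congr1 (fun M : toeplitz_alg F k => toeplitz_val M ord0 (inord d))).
rewrite [RHS]mxE => E; rewrite -[RHS]E horner_sum.
rewrite (big_morph (@toeplitz_val F k) (fun _ _ => erefl) erefl) summxE.
rewrite [LHS]big_mkcond; apply: eq_bigr => x _.
rewrite -[RHS]/((_ *: toeplitz_val (t ^+ count odd x.2)) _ _).
rewrite mxE toeplitz_shiftX add0n inordK ?prednK // eq_sym.
by case: eqP; rewrite ?mulr1 ?mulr0 // hornerZ hornerXn.
Qed.

Lemma Idtr_toeplitz :
  Idtr A = Ttr_ideal_gen [set f1 F; g6 alpha; g7 alpha k]%classic.
Proof.
set I := Ttr_ideal_gen _.
have I_Id : (I `<=` Idtr A)%classic.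
  apply: smallest_sub; first exact: Idtr_Ttr_ideal.
  by move=> _ [[->|->]|->]; [exact: Idtr_f1|exact: Idtr_g6|exact: Idtr_g7].
rewrite eqEsubset; split=> // f fId.
have II : Ttr_ideal I := Ttr_ideal_gen_ideal _.
have I_gen : ([set f1 F; g6 alpha; g7 alpha k] `<=` I)%classic.
  exact: sub_gen_smallest.
have If1 : I (f1 F) by apply: I_gen; left; left.
have Ig6 : I (g6 alpha) by apply: I_gen; left; right.
have Ig7 : I (g7 alpha k) by apply: I_gen; right.
have [u fu] := all_has_nf alpha_neq0 II If1 Ig6 f.
pose iota : {rmorphism F -> trpoly F} := malgC \o malgC.
have uId : Idtr A (lincomb iota (nilgen alpha) u).
  move=> a; have := I_Id _ fu a => /(etrans (esym (alg_evalB a _ _))).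
  by rewrite [alg_eval a f]fId sub0r => /eqP; rewrite oppr_eq0 => /eqP.
have II0 := Ttr_ideal0 II; have ID := Ttr_idealD II.
have IMl := Ttr_idealMl II; have IMr := Ttr_idealMr II.
have IC := Ttr_ideal_comm II If1.
apply: (ideal_eq_mod ID fu).
(* With this N no letter of a word of u occurs N times, so that the weight
   determines the word up to permutation. *)
pose N := (\max_(x <- u) size x.2).+1.
have szN x : x \in u -> (size x.2 < N)%N.
  by move=> xu; rewrite ltnS; exact: leq_bigmax_seq.
have permN x y : x \in u -> y \in u -> weight N x.2 = weight N y.2 ->
    perm_eq x.2 y.2.
  by move=> /szN xN /szN yN; exact: weight_inj.
apply: (@lincomb_ideal _ _ _ II0 ID IMl _ _ (weight N)) => [x y xu yu|x xu].
  by move=> /(permN x y xu yu) xy; exact: gprod_perm.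
have [le_k|lt_k] := leqP k (count odd x.2); [left|right].
  exact: (gprod_nilgen_ideal II If1 Ig7 le_k).
rewrite -[RHS](@Idtr_lincomb_coef N iota u _ (weight N x.2)
                 (fun=> erefl) lt_k uId).
(* Words of equal weight are permutations of one another, hence have the same
   z-degree. *)
rewrite big_seq_cond [RHS]big_seq_cond; apply: eq_bigl => y.
case: (boolP (y \in u)) => //= yu.
case: eqP => [/(permN y x yu xu) yx|]; last by rewrite andbF.
by have /permP -> := yx; rewrite eqxx.
Qed.
End ToeplitzIdentities.

(** * Spans, and the dimension of a quotient *)

(** The vectors live in a module over R and are combined with scalars from F
    through h, as multilinear trace polynomials are. *)
Section SpanDimension.
Variables (F : fieldType) (R : comNzRingType) (h : {rmorphism F -> R}).
Variable U : lmodType R.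

Section Span.
Variable E : U -> Prop.

Definition in_span (f : U) : Prop :=
  exists (m : nat) (c : 'I_m -> F) (e : 'I_m -> U),
    (forall i, E (e i)) /\ f = \sum_(i < m) h (c i) *: e i.

Lemma in_span0 : in_span 0.
Proof.
exists 0%N, (fun _ => 0), (fun _ => 0); split; first by case.
by rewrite big_ord0.
Qed.

Lemma in_spanD f g : in_span f -> in_span g -> in_span (f + g).
Proof.
move=> [m [c [e [eM ->]]]] [m' [c' [e' [e'M ->]]]].
exists (m + m')%N,
  (fun i => match split i with inl j => c j | inr j => c' j end),
  (fun i => match split i with inl j => e j | inr j => e' j end).
split=> [i|]; first by case: (split i).
rewrite [RHS]big_split_ord; congr (_ + _); apply: eq_bigr => i _.
  by rewrite -[lshift _ _]/(unsplit (inl i)) unsplitK.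
by rewrite -[rshift _ _]/(unsplit (inr i)) unsplitK.
Qed.

Lemma mem_in_span f : E f -> in_span f.
Proof.
move=> fE; exists 1%N, (fun _ => 1), (fun _ => f); split=> //.
by rewrite big_ord1 rmorph1 scale1r.
Qed.

Lemma in_spanZ c f : in_span f -> in_span (h c *: f).
Proof.
move=> [m [d [e [eE ->]]]]; exists m, (fun i => c * d i), e; split=> //.
by rewrite scaler_sumr; apply: eq_bigr => i _; rewrite rmorphM scalerA.
Qed.

Lemma in_spanB f g : in_span f -> in_span g -> in_span (f - g).
Proof.
move=> fE /(in_spanZ (-1)) gE; rewrite -scaleN1r -(rmorphN1 h).
exact: in_spanD.
Qed.

Lemma in_span_ind (P : U -> Prop) :
    P 0 -> (forall f g, P f -> P g -> P (f + g)) ->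
    (forall c f, P f -> P (h c *: f)) -> (forall f, E f -> P f) ->
  forall f, in_span f -> P f.
Proof.
move=> P0 PD PZ PE f [m [c [e [eE ->]]]].
by apply: big_ind => // i _; apply/PZ/PE.
Qed.
End Span.

Section QuotientDimension.
Variables V W : U -> Prop.
Hypotheses (W0 : W 0) (WD : forall f g, W f -> W g -> W (f + g)).
Hypothesis WZ : forall (c : F) f, W f -> W (h c *: f).

Definition quotient_free d (e : 'I_d -> U) := forall c : 'I_d -> F,
  W (\sum_(i < d) h (c i) *: e i) -> forall i, c i = 0.

Definition quotient_spanning d (e : 'I_d -> U) := forall v, V v ->
  exists c : 'I_d -> F, W (v - \sum_(i < d) h (c i) *: e i).

(** Expressing e in terms of e' modulo W gives a matrix; with more rows than
    columns it has a nonzero left kernel, that is, a nontrivial relation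
    between the e i modulo W. *)
Lemma quotient_free_le d d' (e : 'I_d -> U) (e' : 'I_d' -> U) :
    (forall i, V (e i)) -> quotient_free e -> quotient_spanning e' ->
  (d <= d')%N.
Proof.
move=> eV e_free e'_span.
have /fin_all_exists[M eM] i := e'_span _ (eV i).
rewrite leqNgt; apply/negP => lt_dd'.
pose A := \matrix_(i < d, j < d') M i j.
have : kermx A != 0.
  rewrite kermx_eq0 -row_leq_rank -ltnNge.
  exact: leq_ltn_trans (rank_leq_col A) lt_dd'.
case/rowV0Pn=> c /sub_kermxP cA; apply/negP; rewrite negbK; apply/eqP/rowP => i.
rewrite mxE; apply: (e_free (fun i => c 0 i)).
have -> : \sum_(i < d) h (c 0 i) *: e i
    = \sum_(i < d) h (c 0 i) *: (e i - \sum_(j < d') h (M i j) *: e' j).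
  apply/eqP; rewrite -subr_eq0 -sumrB.
  under eq_bigr => l _ do rewrite -scalerBr opprB addrC subrK scaler_sumr.
  rewrite exchange_big big1 //= => j _.
  under eq_bigr => l _ do rewrite scalerA -rmorphM.
  rewrite -scaler_suml -rmorph_sum.
  have /matrixP/(_ 0 j) := cA; rewrite !mxE => cA0.
  rewrite (_ : \sum_(l < d) _ = 0) ?rmorph0 ?scale0r // -[RHS]cA0.
  by apply: eq_bigr => l _; rewrite mxE.
by apply: big_ind => // l _; exact: WZ.
Qed.

Lemma quotient_spanning_span (E : U -> Prop) d (e : 'I_d -> U) :
    (forall f, V f -> in_span E f) ->
    (forall f, E f ->
       exists c : 'I_d -> F, W (f - \sum_(i < d) h (c i) *: e i)) ->
  quotient_spanning e.
Proof.
move=> VE Ee f /VE; move: f.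
apply: in_span_ind => [|f g [c cf] [c' cg]|c f [c' cf]|//].
- exists (fun=> 0); rewrite big1 ?subr0 // => i _.
  by rewrite rmorph0 scale0r.
- exists (fun i => c i + c' i).
  under eq_bigr do rewrite rmorphD scalerDl.
  by rewrite big_split opprD addrACA; exact: WD.
exists (fun i => c * c' i).
under eq_bigr do rewrite rmorphM -scalerA.
by rewrite -scaler_sumr -scalerBr; exact: WZ.
Qed.
End QuotientDimension.
End SpanDimension.

(** * Multilinear trace polynomials *)

Section Multilinear.
Variable F : fieldType.
Implicit Types (f g : trpoly F) (n : nat).

Let hC : {rmorphism F -> puretr F} := malgC.
Let MT0 n : MT n (0 : trpoly F) := in_span0 hC _.
Let MTD n f g : MT n f -> MT n g -> MT n (f + g) := @in_spanD _ _ hC _ _ f g.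
Let MTZ n (c : F) f : MT n f -> MT n (c%:MP *: f) := @in_spanZ _ _ hC _ _ c f.

Lemma MT_mulr n n' g f :
    (forall e, multilin_monomial n e -> multilin_monomial n' (e * g)) ->
  MT n f -> MT n' (f * g).
Proof.
move=> eg; apply: (in_span_ind (h := hC) (P := fun f => MT n' (f * g))).
- by rewrite mul0r; exact: MT0.
- by move=> p q Pp Pq; rewrite mulrDl; exact: MTD.
- by move=> c p Pp; rewrite -scalerAl; exact: MTZ.
by move=> e /eg; exact: (mem_in_span hC).
Qed.

Lemma iota0S n : iota 0 n.+1 = iota 0 n ++ [:: n].
Proof. by rewrite -addn1 iotaD. Qed.

Lemma multilin_mul_var n e :
  multilin_monomial n e -> multilin_monomial n.+1 (e * var F n).
Proof.
move=> [us [w [us0 uw ->]]]; exists us, (w ++ [:: n]); split; first exact: us0.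
  by rewrite iota0S catA perm_cat2r.
apply: etrans (esym (mulrA _ _ _)) _; apply: congr2 => //.
exact/esym/word_cat.
Qed.

Lemma multilin_mul_Tr n e :
  multilin_monomial n e -> multilin_monomial n.+1 (e * Tr (var F n)).
Proof.
move=> [us [w [us0 uw ->]]]; exists ([:: n] :: us), w; split; first exact: us0.
  by rewrite iota0S perm_sym perm_catC /= perm_cons perm_sym.
rewrite big_cons; apply: etrans (malgC_central _ _) _.
exact: mulrA.
Qed.

(** The product of z_i for i in S and of y_i for i not in S; S is a predicate on
    nat, not on 'I_n, for the sake of induction on n. *)
Definition nilprod alpha n (S : pred nat) : trpoly F :=
  \prod_(i < n) nilgen alpha (S i + i.*2).

Lemma nilgenE alpha (b : bool) i : nilgen alpha (b + i.*2) =
  if b then Tr (var F i) - alpha%:MP *: var F i else Tr (var F i).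
Proof.
rewrite /nilgen oddD odd_double addbF oddb half_bit_double.
by case: b.
Qed.

Lemma MT_nilprod alpha n S : MT n (nilprod alpha n S).
Proof.
elim: n => [|n IHn].
  rewrite /nilprod big_ord0; exists 1%N, (fun _ => 1), (fun _ => 1).
  split=> [_|]; last by rewrite big_ord1 mpolyC1E scale1r.
  exists [::], [::]; split=> //; rewrite big_nil mul1r /word FMonom_nil.
  exact/esym/mpolyC1E.
rewrite /nilprod big_ord_recr nilgenE /=.
have MTy : MT n.+1 (nilprod alpha n S * Tr (var F n)).
  exact: MT_mulr (@multilin_mul_Tr n) IHn.
case: (S n); last exact: MTy.
have MTx : MT n.+1 (nilprod alpha n S * var F n).
  exact: MT_mulr (@multilin_mul_var n) IHn.
have := MTD MTy (MTZ (- alpha) MTx).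
rewrite monalgUN scaleNr malg_scaleAr.
by rewrite -[X in MT _ X -> _]mulrBr.
Qed.
End Multilinear.

(** * The trace codimensions of the Toeplitz algebra *)

HB.instance Definition _ (F : fieldType) (k : nat) :=
  GRing.PzRing_hasCommutativeMul.Build (toeplitz_alg F k) (@toeplitz_mulC F k).

Section NilSet.
Variables (F : fieldType) (alpha : F) (n : nat).

Definition nilset (S : {set 'I_n}) : trpoly F :=
  nilprod alpha n (fun i => i \in map val (enum S)).

Lemma MT_nilset S : MT n (nilset S).
Proof. exact: MT_nilprod. Qed.

Lemma alg_eval_nilset (A : traceAlgType F) (a : nat -> A) S :
  alg_eval a (nilset S) = \prod_(i < n) (if i \in S
    then (tralg_tr A (a i))%:A - alpha *: a i else (tralg_tr A (a i))%:A).
Proof.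
apply: etrans (alg_eval_prod a _ _ _) _; apply: eq_bigr => i _.
rewrite nilgenE (mem_map val_inj) mem_enum; case: ifP => _.
  exact: alg_eval_nilpart.
exact: alg_eval_Tr_var.
Qed.
End NilSet.

Section Codimension.
Variables (F : fieldType) (alpha : F) (alpha_neq0 : alpha != 0).
Variables (k : nat) (k_gt0 : (0 < k)%N) (n : nat).
Local Notation T := (toeplitz_alg F k).
Local Notation A := (toeplitz_tralg k alpha).
Local Notation t := (toeplitz_shift F k).

Definition trpart (M : T) : T := (tralg_tr A M)%:A.
Definition nilpart (M : T) : T := trpart M - alpha *: M.

Lemma eval_nilset (a : nat -> T) (S : {set 'I_n}) :
  alg_eval (a : nat -> A) (nilset alpha S)
    = \prod_(i < n) (if i \in S then nilpart (a i) else trpart (a i)).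
Proof. exact: alg_eval_nilset. Qed.

Lemma eval_nilset_large (a : nat -> T) (S : {set 'I_n}) : (k <= #|S|)%N ->
  \prod_(i < n) (if i \in S then nilpart (a i) else trpart (a i)) = 0.
Proof.
move=> le_k; rewrite (bigID (mem S)) /=.
under eq_bigr => i -> do [].
rewrite toeplitz_nilpart_prod ?mul0r //.
by rewrite -sum1_count sum1_card.
Qed.

(** The coefficients of the expansion in [eval_monomial]. Each factor x_i of w
    is 1/alpha (y_i - z_i) and each factor eps(x_i) from a trace is 1/alpha y_i;
    a trace contributes one more factor alpha. *)
Definition monomial_coef (us : seq (seq nat)) (w : seq nat)
    (S : {set 'I_n}) : F :=
  alpha ^+ size us * alpha^-1 ^+ n
    * \prod_(i < n) (if i \in S then - ((i : nat) \in w)%:R else 1).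

Lemma toeplitz_diag_weval (a : nat -> T) u :
  toeplitz_diag (weval a u) = \prod_(i <- u) toeplitz_diag (a i).
Proof.
rewrite /weval; elim: u => [|i u IHu].
  by rewrite !big_nil /toeplitz_diag mxE eqxx.
by rewrite !big_cons toeplitz_diagM IHu.
Qed.

Lemma eval_monomial (a : nat -> T) us w :
    all (fun u => u != [::]) us -> perm_eq (flatten us ++ w) (iota 0 n) ->
  alg_eval (a : nat -> A) ((\prod_(u <- us) Tr (word F u)) * word F w)
    = \sum_(S : {set 'I_n}) monomial_coef us w S *:
        \prod_(i < n) (if i \in S then nilpart (a i) else trpart (a i)).
Proof.
move=> us0 us_w; apply: etrans (alg_evalM _ _ _) _; rewrite alg_eval_word.
have -> : alg_eval (a : nat -> A) (\prod_(u <- us) Tr (word F u))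
    = alpha ^+ size us *: \prod_(i <- flatten us) (toeplitz_diag (a i))%:A :> T.
  apply: etrans (alg_eval_prod (a : nat -> A) _ _ _) _.
  elim: us us0 {us_w} => [|u us IHus] /=; first by rewrite !big_nil scale1r.
  case/andP=> u0 /IHus {}IHus; rewrite big_cons IHus big_cat /= exprS.
  rewrite (alg_eval_Tr _ (no_pure_word F u0)) alg_eval_word toeplitz_trE.
  rewrite toeplitz_diag_weval -!(rmorph_prod (in_alg T)) /=.
  by rewrite !mulr_algl !scalerA (mulrAC alpha).
(* The value of the monomial is alpha^(size us) times the product of the G i,
   each variable occurring in exactly one of flatten us and w. *)
pose G i : T := if i \in w then a i else (toeplitz_diag (a i))%:A.
have uniq_w : uniq (flatten us ++ w) by rewrite (perm_uniq us_w) iota_uniq.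
have {uniq_w} E : (\prod_(i <- flatten us) (toeplitz_diag (a i))%:A) * weval a w
    = \prod_(i < n) G i.
  rewrite -(big_mkord xpredT G) /index_iota subn0 -(perm_big _ us_w) big_cat /=.
  rewrite /weval; congr (_ * _); rewrite !big_seq; apply: eq_bigr => i i_in.
    rewrite /G; case: ifP => // iw.
    by move: uniq_w; rewrite cat_uniq => /and3P[_ /hasPn/(_ i iw)/negP].
  by rewrite /G i_in.
rewrite -scalerAl E.
have GE i : G i = alpha^-1 *: (- (i \in w)%:R *: nilpart (a i) + trpart (a i)).
  rewrite /G /nilpart /trpart toeplitz_trE; case: (i \in w).
    by rewrite scaleN1r opprB subrK scalerA mulVf // scale1r.
  by rewrite oppr0 scale0r add0r scalerA mulrA mulVf // mul1r.
under eq_bigr do rewrite GE.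
rewrite scaler_prod prodr_const card_ord scalerA bigA_distr scaler_sumr.
apply: eq_bigr => S _; rewrite /monomial_coef -[RHS]scalerA; congr (_ *: _).
rewrite -scaler_prod; apply: eq_bigr => i _.
by case: (i \in S); rewrite ?scale1r.
Qed.

Definition indicator_point (S : {set 'I_n}) (i : nat) : T :=
  if i \in map val (enum S) then t else 1.

(** At t the value of y_i vanishes, and at 1 that of z_i does. *)
Lemma eval_nilset_indicator (S S' : {set 'I_n}) :
  alg_eval (indicator_point S : nat -> A) (nilset alpha S')
    = if S' == S
      then (\prod_(i < n) (if i \in S then - alpha else alpha)) *: t ^+ #|S|
      else 0.
Proof.
have tr_t : trpart t = 0.
  by rewrite /trpart toeplitz_trE /toeplitz_diag mxE mulr0 scale0r.
have tr_1 : trpart 1 = alpha%:A.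
  by rewrite /trpart toeplitz_trE /toeplitz_diag mxE eqxx mulr1.
have pointE (i : 'I_n) : indicator_point S i = if i \in S then t else 1.
  by rewrite /indicator_point (mem_map val_inj) mem_enum.
rewrite eval_nilset; case: eqP => [->|neq].
  have -> : t ^+ #|S| = \prod_(i < n) (if i \in S then t else 1).
    by rewrite -big_mkcond prodr_const.
  rewrite -scaler_prod; apply: eq_bigr => i _.
  rewrite pointE; case: (i \in S); last by rewrite tr_1.
  by rewrite /nilpart tr_t sub0r scaleNr.
have /existsP[i i_neq] : [exists i, (i \in S') != (i \in S)].
  apply: contra_notT neq; rewrite negb_exists => /forallP eqS.
  by apply/setP => i; apply/eqP; rewrite -[_ == _]negbK; exact: eqS.
rewrite (bigD1 i) //= pointE; move: i_neq.
case: (i \in S'); case: (i \in S) => //= _; last by rewrite tr_t mul0r.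
by rewrite /nilpart tr_1 subrr mul0r.
Qed.

Definition small_sets : {set {set 'I_n}} :=
  [set S : {set 'I_n} | (#|S| < k)%N]%SET.

Definition small_nilset (j : 'I_#|small_sets|) := nilset alpha (enum_val j).

(** At the point of S the linear combination has value a nonzero multiple of
    c_S t^#|S|, and t^#|S| is nonzero because #|S| < k. *)
Lemma small_nilset_free (c : 'I_#|small_sets| -> F) :
    Idtr A (\sum_j (c j)%:MP *: small_nilset j) ->
  forall j, c j = 0.
Proof.
move=> c0 j; pose S := enum_val j; have := c0 (indicator_point S : nat -> A).
move/(etrans (esym (alg_eval_sum _ _ _ _))).
rewrite (eq_bigr _ (fun i _ => alg_evalZC _ (c i) _)) (bigD1 j) //=.
rewrite [X in _ + X]big1 ?addr0 => [|i ij]; last first.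
  rewrite eval_nilset_indicator ifN ?scaler0 //.
  by apply: contraNneq ij => /enum_val_inj ->.
rewrite eval_nilset_indicator eqxx scalerA => E.
have Sk : (#|S| < k)%N by have := enum_valP j; rewrite inE.
have := congr1 (fun M : T => toeplitz_val M ord0 (inord #|S|)) E.
rewrite -[LHS]/((_ *: toeplitz_val (t ^+ #|S|)) _ _) [RHS]mxE.
rewrite mxE toeplitz_shiftX add0n inordK ?prednK // eqxx mulr1 => /eqP.
rewrite mulf_eq0 => /orP[/eqP //|/prodf_eq0[i _]].
by case: ifP; rewrite ?oppr_eq0 (negbTE alpha_neq0).
Qed.

Lemma small_nilset_spanning f : multilin_monomial n f ->
  exists c : 'I_#|small_sets| -> F,
    (MT n `&` Idtr A)%classic (f - \sum_j (c j)%:MP *: small_nilset j).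
Proof.
move=> fM; have [us [w [us0 us_w fE]]] := fM.
exists (fun j => monomial_coef us w (enum_val j)); split.
  have := @in_spanB F (puretr F) malgC (trpoly F) (multilin_monomial n).
  apply; first exact: mem_in_span.
  apply: big_ind; [exact: in_span0|exact: in_spanD|move=> j _].
  exact/in_spanZ/MT_nilset.
move=> a; apply: etrans (alg_evalB a _ _) _.
rewrite {1}fE [X in X - _](eval_monomial a us0 us_w).
rewrite [X in _ - X](alg_eval_sum a).
rewrite [X in _ - X](eq_bigr _ (fun i _ => alg_evalZC a _ _)).
rewrite (bigID (mem small_sets)) /= [X in _ + X - _]big1 => [|S]; last first.
  by rewrite inE -leqNgt => /(eval_nilset_large a) ->; rewrite scaler0.
rewrite addr0 big_enum_val; apply/eqP; rewrite subr_eq0; apply/eqP.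
by apply: eq_bigr => j _; rewrite eval_nilset.
Qed.

Lemma card_small_sets : #|small_sets| = (\sum_(i < k) 'C(n, i))%N.
Proof.
rewrite /small_sets; elim: k => [|l IHl].
  by rewrite big_ord0; apply: eq_card0 => S; rewrite inE ltn0.
rewrite big_ord_recr /= -IHl -[X in 'C(X, l)](card_ord n) -card_draws -cardsUI.
rewrite [X in (_ + X)%N](_ : _ = 0%N) ?addn0; last first.
  by apply: eq_card0 => S; rewrite !inE; case: ltngtP.
by apply: eq_card => S; rewrite !inE ltnS leq_eqVlt orbC.
Qed.

Lemma toeplitz_trcodim : trcodim A n = (\sum_(i < k) 'C(n, i))%N.
Proof.
rewrite -card_small_sets.
pose h : {rmorphism F -> puretr F} := malgC.
have W0 : (MT n `&` Idtr A)%classic 0.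
  by split; [exact: (in_span0 h)|exact: (Ttr_ideal0 (Idtr_Ttr_ideal A))].
have WD f g : (MT n `&` Idtr A)%classic f -> (MT n `&` Idtr A)%classic g ->
    (MT n `&` Idtr A)%classic (f + g).
  move=> [fM f0] [gM g0]; split; first exact: (@in_spanD _ _ h).
  exact: (Ttr_idealD (Idtr_Ttr_ideal A)).
have WZ c f : (MT n `&` Idtr A)%classic f ->
    (MT n `&` Idtr A)%classic (h c *: f).
  move=> [fM f0]; split; first exact: (@in_spanZ _ _ h).
  rewrite -mul_malgC; exact: (Ttr_idealMl (Idtr_Ttr_ideal A)).
have dimE : has_quotient_dim (MT n) (MT n `&` Idtr A)%classic #|small_sets|.
  exists small_nilset; split=> [j|c [_]|].
  - exact: MT_nilset.
  - exact: small_nilset_free.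
  apply: (@quotient_spanning_span _ _ h _ _ _ W0 WD WZ (multilin_monomial n)).
    by [].
  exact: small_nilset_spanning.
apply: xget_unique => // d [e [eM e_free e_span]].
have [e' [e'M e'_free e'_span]] := dimE.
apply/eqP; rewrite eqn_leq.
rewrite (quotient_free_le (h := h) W0 WD WZ eM e_free e'_span).
exact: (quotient_free_le (h := h) W0 WD WZ e'M e'_free e_span).
Qed.

End Codimension.

(** * Asymptotics of sums of binomial coefficients *)

Import numFieldNormedType.Exports.

Section BinomialSum.
Variable R : realType.
Local Open Scope classical_set_scope.

Lemma cvg_invn : (n%:R^-1 : R) @[n --> \oo] --> (0 : R).
Proof. by rewrite -cvg_shiftS; exact: cvg_harmonic. Qed.

Lemma cvg_invnX m : ((n%:R^-1 : R) ^+ m) @[n --> \oo] --> (0 ^+ m : R).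
Proof.
elim: m => [|m IHm]; first by under eq_cvg do rewrite expr0; exact: cvg_cst.
under eq_cvg do rewrite exprS; rewrite exprS.
by apply: cvgM; [exact: cvg_invn|].
Qed.

(** The ratio is the product of the (n - j) / n for j < i. *)
Lemma cvg_ffact_ratio i :
  ((n ^_ i)%:R * n%:R^-1 ^+ i : R) @[n --> \oo] --> (1 : R).
Proof.
elim: i => [|i IHi].
  by under eq_cvg do rewrite ffactn0 expr0 mulr1; exact: cvg_cst.
under eq_cvg do rewrite ffactnSr natrM exprSr mulrACA.
suff n_sub : ((n - i)%:R * n%:R^-1 : R) @[n --> \oo] --> (1 : R).
  by have := cvgM IHi n_sub; rewrite mulr1 => prod_cvg; exact: prod_cvg.
have : (1 - i%:R * n%:R^-1 : R) @[n --> \oo] --> (1 - i%:R * 0 : R).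
  apply: cvgB; first exact: cvg_cst.
  by apply: cvgM; [exact: cvg_cst|exact: cvg_invn].
rewrite mulr0 subr0; apply: cvg_trans; apply: near_eq_cvg.
exists i.+1 => // n /= lt_in.
have le_in := ltnW lt_in.
by rewrite natrB // mulrBl mulfV // pnatr_eq0 -lt0n (leq_trans _ lt_in).
Qed.

Lemma binomial_sum_asymp k : (0 < k)%N ->
  asymp_eq (fun n => (\sum_(i < k) 'C(n, i))%N%:R : R)
           (fun n => n%:R ^+ k.-1 / (k.-1)`!%:R).
Proof.
case: k => // k _; rewrite /asymp_eq /=.
have fact_neq0 i : (i`!%:R : R) != 0 by rewrite pnatr_eq0 -lt0n fact_gt0.
(* u i n is 'C(n, i) divided by n ^ k / k!, and l i is its limit. *)
pose u (i : 'I_k.+1) n : R := ((n ^_ i)%:R * n%:R^-1 ^+ i)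
  * (n%:R^-1 ^+ (k - i) * (k`!%:R / i`!%:R)).
pose l (i : 'I_k.+1) : R := 1 * (0 ^+ (k - i) * (k`!%:R / i`!%:R)).
have uE n : (\sum_(i < k.+1) 'C(n, i))%N%:R / (n%:R ^+ k / k`!%:R)
    = \sum_(i < k.+1) u i n.
  rewrite natr_sum mulr_suml; apply: eq_bigr => i _; rewrite /u.
  have -> : (n%:R ^+ k / k`!%:R : R)^-1
      = n%:R^-1 ^+ i * n%:R^-1 ^+ (k - i) * k`!%:R.
    by rewrite -exprD subnKC ?invfM ?invrK ?exprVn // -ltnS.
  rewrite -bin_ffact natrM.
  have := fact_neq0 i; move: (i`!%:R : R) => c c0.
  by field.
under eq_cvg do rewrite uE.
have <- : \sum_(i < k.+1) l i = 1.
  rewrite big_ord_recr big1 /l /= => [|i _].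
    by rewrite subnn expr0 !mul1r add0r mulfV ?fact_neq0.
  by rewrite expr0n subn_eq0 leqNgt ltn_ord mul0r mulr0.
apply: (cvg_big (op := +%R)); first exact: add_continuous.
move=> i _; apply: cvgM; first exact: cvg_ffact_ratio.
by apply: cvgM; [exact: cvg_invnX|exact: cvg_cst].
Qed.
End BinomialSum.

Theorem theorem22 (F : fieldType) (charF0 : [pchar F] =i pred0)
    (alpha : F) (alpha_neq0 : alpha != 0) (k : nat) (k_ge2 : (2 <= k)%N)
    (R : realType) :
  [/\ Idtr (toeplitz_tralg k alpha)
        = Ttr_ideal_gen [set f1 F; g6 alpha; g7 alpha k]%classic,
      forall n : nat, (1 <= n)%N ->
        trcodim (toeplitz_tralg k alpha) n = (\sum_(i < k) 'C(n, i))%N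
    & asymp_eq (fun n => (trcodim (toeplitz_tralg k alpha) n)%:R : R)
        (fun n => n%:R ^+ k.-1 / (k.-1)`!%:R)].
Proof.
have k_gt0 : (0 < k)%N by exact: ltnW.
split=> [|n _|]; first exact: Idtr_toeplitz.
  exact: toeplitz_trcodim.
under eq_fun do rewrite toeplitz_trcodim //.
exact: binomial_sum_asymp.
Qed.
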